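(* Let $\{\ell_n\}_{n\ge1}$ be a decreasing sequence of positive numbers with $\sum_n\ell_n<\infty$. Fix $x\in C$ and, for either dynamical circle covering model (Brownian or Poisson) with lengths $\{\ell_n\}$ and associated random sets $E_t\subseteq C$, let $T:=\{t\in[0,1]:x\in E_t\}$. (a) In the Brownian model, $P(T\ne\varnothing)=1$. (b) In the Poisson model with parameter $\alpha\ge0$: if $\sum_n\ell_n^{1-\alpha}<\infty$, then $P(T=\varnothing)=1$, while if $\sum_n\ell_n^{1-\alpha}=\infty$, then $P(T\neq\varnothing)=1$.
   Context: $C$ is the circle of circumference $1$, viewed as the quotient of $\mathbb{R}$ by $\mathbb{Z}$ via $u\mapsto \frac1{2\pi}(\cos 2\pi u,\sin2\pi u)$. Brownian model: $\{U_{n,t}\}_{t\ge0}$, $n\ge1$, are independent Brownian motions on $C$ (the projections to $C$ of Brownian motions on $\mathbb{R}$ with variance $1$ per unit time, with continuous paths), each started from the uniform distribution on $C$. Poisson model with parameter $\alpha\ge0$: let $\{C_{i,j}\}_{i,j\ge1}$ and $\{Y_{i,j}\}_{i,j\ge1}$ be mutually independent random variables, with $C_{i,j}$ uniformly distributed on $C$ and $Y_{i,j}$ exponentially distributed with rate parameter $\ell_i^{-\alpha}$; let $T_{i,0}:=0$ and $T_{i,j}:=\sum_{k=1}^jY_{i,k}$ for $j\ge1$, and let $U_{i,t}:=C_{i,j}$ for $t\in[T_{i,j-1},T_{i,j})$. In either model, $I_{n,t}$ is the open arc of $C$ with center $U_{n,t}$ and length $\ell_n$ (an arc of length greater than $1$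 is all of $C$), and $E_t:=\limsup_n I_{n,t}$ is the set of points belonging to $I_{n,t}$ for infinitely many $n$. *)

(* Defs.v *)
From HB Require Import structures.
From mathcomp Require Import all_boot all_order all_algebra ring_quotient.
From mathcomp Require Import all_classical all_reals all_analysis.

Set Implicit Arguments.
Unset Strict Implicit.
Unset Printing Implicit Defensive.

Import Order.TTheory GRing.Theory Num.Theory.
Import numFieldNormedType.Exports.

Local Open Scope classical_set_scope.
Local Open Scope ring_scope.

(* Num.int, as an additive subgroup of R *)
Definition int_subgroup (R : realType) : zmodClosed R :=
  GRing.ZmodClosed.clone R (@Num.int_num_subdef R) _.

(* R / Z with its quotient topology; [0, 1] maps onto it, so its circumference
   is 1 and arc length is length in R. *)
Definition circle (R : realType) : Type :=
  quotient_topology (Quotient.quot (int_subgroup R)).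

HB.instance Definition _ (R : realType) := PointedTopological.on (circle R).
HB.instance Definition _ (R : realType) := Quotient.on (circle R).
(* Borel sigma-algebra *)
HB.instance Definition _ (R : realType) :=
  Measurable.copy (circle R) (g_sigma_algebraType (@open (circle R))).

Definition to_circle {R : realType} (u : R) : circle R :=
  (\pi_(circle R)%qT u)%qT.

(* Open arc with center c and length l; the choice of the representative of c
   is irrelevant, and l > 1 gives the whole circle. *)
Definition arc {R : realType} (c : circle R) (l : R) : set (circle R) :=
  to_circle @` ball (repr c : R) (l / 2).

Definition circle_uniform {R : realType} : set (circle R) -> \bar R :=
  pushforward (uniform_prob (@ltr01 R)) to_circle.

Definition has_law {d d'} {T : measurableType d} {T' : measurableType d'}
    {R : realType} (P : probability T R) (X : T -> T')
    (mu : set T' -> \bar R) : Prop :=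
  measurable_fun [set: T] X /\
  forall A : set T', measurable A -> pushforward P X A = mu A.

(* The sets of events F i are meant to be closed under intersection, e.g.
   sigma-algebras, so that the product rule expresses their independence. *)
Definition mutually_independent {d} {T : measurableType d} {R : realType}
    (P : probability T R) {I : eqType} (F : I -> set_system T) : Prop :=
  forall (s : seq I) (A : I -> set T), uniq s ->
    (forall i, i \in s -> F i (A i)) ->
    P (\bigcap_(i in [set` s]) A i) = (\prod_(i <- s) P (A i))%E.

Definition sigma_of {d d'} {T : measurableType d} {T' : measurableType d'}
    (X : T -> T') : set_system T :=
  preimage_set_system [set: T] X measurable.

Definition sigma_of_process {d d'} {R : realType} {T : measurableType d}
    {T' : measurableType d'} (X : R -> T -> T') : set_system T :=
  <<s \bigcup_(t in [set t : R | 0 <= t]) sigma_of (X t) >>.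

(* Real Brownian motion with variance 1 per unit time and arbitrary initial
   law. A finite list of times 0 <= t_1 <= ... <= t_k is extended to a sequence
   by repeating t_k; normal_prob takes the standard deviation. *)
Definition brownian_motion {d} {T : measurableType d} {R : realType}
    (P : probability T R) (B : R -> T -> R) : Prop :=
  [/\ forall t, 0 <= t -> measurable_fun [set: T] (B t),
      forall w, {within [set t : R | 0 <= t], continuous (fun t => B t w)},
      forall s t, 0 <= s -> s < t ->
        has_law P (fun w => B t w - B s w) (normal_prob 0 (Num.sqrt (t - s)))
    & forall t : nat -> R, t 0%N = 0 -> nondecreasing_seq t ->
        mutually_independent P (fun k : nat => sigma_of
          (if k is k'.+1 then fun w => B (t k'.+1) w - B (t k') w else B 0))].

Definition circle_brownian_motion {d} {T : measurableType d} {R : realType}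
    (P : probability T R) (U : R -> T -> circle R) : Prop :=
  (exists B : R -> T -> R, brownian_motion P B /\
    forall t w, 0 <= t -> U t w = to_circle (B t w)) /\
  has_law P (U 0) circle_uniform.

(* Sequences indexed by n >= 1 are shifted to start at 0 throughout. *)
Definition brownian_model {d} {T : measurableType d} {R : realType}
    (P : probability T R) (U : nat -> R -> T -> circle R) : Prop :=
  (forall n, circle_brownian_motion P (U n)) /\
  mutually_independent P (fun n => sigma_of_process (U n)).

Definition poisson_input {d} {T : measurableType d} {R : realType}
    (P : probability T R) (l : nat -> R) (alpha : R)
    (C : nat -> nat -> T -> circle R) (Y : nat -> nat -> T -> R) : Prop :=
  [/\ forall i j, has_law P (C i j) circle_uniform,
      forall i j, has_law P (Y i j) (exponential_prob (l i `^ (- alpha)))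
    & mutually_independent P (fun k : (nat * nat) + (nat * nat) =>
        match k with
        | inl (i, j) => sigma_of (C i j)
        | inr (i, j) => sigma_of (Y i j)
        end)].

Definition jump_time {T : Type} {R : realType} (Y : nat -> nat -> T -> R)
    (i j : nat) (w : T) : R := \sum_(k < j) Y i k w.

(* Almost surely the holding times are positive with divergent sum, so that
   exactly one j qualifies; on the exceptional null set the value is
   immaterial. *)
Definition poisson_process {T : Type} {R : realType}
    (C : nat -> nat -> T -> circle R) (Y : nat -> nat -> T -> R)
    (i : nat) (t : R) (w : T) : circle R :=
  C i (xget 0%N [set j | jump_time Y i j w <= t < jump_time Y i j.+1 w]) w.

Definition limsup_arcs {T : Type} {R : realType} (l : nat -> R)
    (U : nat -> R -> T -> circle R) (t : R) (w : T) : set (circle R) :=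
  lim_sup_set (fun n => arc (U n t w) (l n)).

Definition covering_times {T : Type} {R : realType} (l : nat -> R)
    (U : nat -> R -> T -> circle R) (x : circle R) (w : T) : set R :=
  [set t | t \in `[0, 1] /\ limsup_arcs l U t w x].

(* Main.v *)
(* Write A_n for the set of times t with x in I_{n,t}, so that T is the limsup of
   the A_n intersected with [0, 1].

   Nonemptiness: if for every pair of rationals p < q in [0, 1] infinitely many
   A_n have interior points in (p, q), then by Baire T is a dense G_delta. For
   fixed p and q these are independent events in n, so by the second
   Borel-Cantelli lemma it suffices that their probabilities have infinite sum.
   In the Brownian model they are bounded below, because an increment
   B_q - B_p > 1 forces the path through x + Z. In the Poisson model with large
   rate r = l^-alpha, Chebyshev's inequality shows that with probability at least
   1/2 the jump times of order J1 ~ r (p + (q - p) / 3) and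
   J2 ~ r (p + 2 (q - p) / 3) lie in (p, q), and independently one of the
   centers C_j, J1 <= j < J2, is within l / 2 of x with probability at least
   y / (1 + y), where y = r l (q - p) / 12; since r l = l^(1 - alpha), the sum of
   these lower bounds diverges.

   Emptiness: the expected number of j with T_j <= 1 and x in the arc around C_j
   is at most a constant times l (1 + r) = l + l^(1 - alpha), by a Chernoff bound
   on T_j, and the first Borel-Cantelli lemma applies. *)
From HB Require Import structures.
From mathcomp Require Import all_boot all_order all_algebra ring_quotient.
From mathcomp Require Import all_classical all_reals all_analysis measurable_realfun.
From mathcomp Require Import lra ring zify.
(* last, because of the unrelated arc of path.v *)
Require Import Defs.

Import Order.TTheory GRing.Theory Num.Theory.
Import numFieldNormedType.Exports.

Set Implicit Arguments.
Unset Strict Implicit.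
Unset Printing Implicit Defensive.

Local Open Scope classical_set_scope.
Local Open Scope ring_scope.

(** * Independence and the Borel-Cantelli lemmas *)

Lemma g_sigma_algebraC T (G : set_system T) A :
  <<s G >> A -> <<s G >> (~` A).
Proof.
by rewrite -setTD; have [_ + _] := smallest_sigma_algebra setT G; exact.
Qed.

Section independence.
Context {d : measure_display} {T : measurableType d} {R : realType}.
Variable P : probability T R.

(** Dynkin's pi-lambda argument: the events independent of [D] form a Dynkin system, and this system
    contains the pi-system [G]. *)
Lemma indep_g_sigma_algebra (G : set_system T) (D : set T) :
  measurable D -> G `<=` measurable -> setI_closed G ->
  (forall A, G A -> P (A `&` D) = (P A * P D)%E) ->
  forall A, <<s G >> A -> P (A `&` D) = (P A * P D)%E.
Proof.
move=> mD mG GI indG A; rewrite -(setI_closed_g_dynkin_g_sigma_algebra GI) => GA.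
have : [set A | measurable A /\ P (A `&` D) = (P A * P D)%E] A; last by case.
apply: GA; split; last by move=> B GB; split; [exact: mG|exact: indG].
split=> /=.
- by split=> //; rewrite setTI probability_setT mul1e.
- move=> B [mB PB]; split; first exact: measurableC.
  rewrite setIC -setDE measureD//; last first.
    by rewrite ltey_eq fin_num_measure.
  rewrite [D `&` B]setIC [X in (_ - X)%E]PB [P (~` B)]probability_setC//.
  by rewrite muleBl ?mul1e// ?fin_num_adde_defl ?fin_numN ?fin_num_measure.
- move=> F tF FP; have mF n : measurable (F n) by case: (FP n).
  split; first exact: bigcup_measurable.
  rewrite setI_bigcupl measure_bigcup//=; last 2 first.
    by move=> n _; exact: measurableI.
    by apply: trivIset_setIr.
  have PDE : P D = (fine (P D))%:E by rewrite fineK// fin_num_measure.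
  rewrite (eq_eseriesr (g := fun n => ((fine (P D))%:E * P (F n))%E)); last first.
    by move=> n _; case: (FP n) => _ ->; rewrite muleC -PDE.
  by rewrite nneseriesZl// -measure_bigcup//= -PDE muleC.
Qed.

Section grouping.
Variables (I J : eqType) (F : I -> set_system T) (g : I -> J).
Hypothesis FT : forall i, F i setT.
Hypothesis FI : forall i, setI_closed (F i).
Hypothesis Fm : forall i, F i `<=` measurable.
Hypothesis indF : mutually_independent P F.

(** The pi-system behind the sigma-algebra generated by the [F i] with [i] in [S]. The family [A] is
    total, with value [setT] off [u], so that two cylinders can be intersected index by index. *)
Definition cylinder (S : set I) : set_system T := [set B |
  exists (u : seq I) (A : I -> set T), [/\ uniq u, forall i, F i (A i),
    forall i, i \in u -> S i, forall i, i \notin u -> A i = setT &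
    B = \bigcap_(i in [set` u]) A i]].

Lemma cylinder_measurable S : cylinder S `<=` measurable.
Proof.
move=> _ [u [A [_ FA _ _ ->]]]; apply: fin_bigcap_measurable => // i _.
exact/Fm/FA.
Qed.

Lemma sub_cylinder {S S'} : S `<=` S' -> cylinder S `<=` cylinder S'.
Proof.
by move=> SS' _ [u [A [uu FA uS uT ->]]]; exists u, A; split=> // i /uS /SS'.
Qed.

Lemma cylinderT S : cylinder S setT.
Proof.
by exists [::], (fun=> setT); split=> //; rewrite set_nil bigcap_set0.
Qed.

Lemma cylinder1 {S : set I} {i A} : S i -> F i A -> cylinder S A.
Proof.
move=> Si FA; exists [:: i], (fun j => if j == i then A else setT).
split=> //.
- by move=> j; case: eqP => // ->.
- by move=> j; rewrite inE => /eqP ->.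
- by move=> j; rewrite inE; case: eqP.
- by rewrite set_cons1 bigcap_set1 eqxx.
Qed.

Lemma bigcap_seq_catI (u u' : seq I) (A A' : I -> set T) :
  (forall i, i \notin u -> A i = setT) ->
  (forall i, i \notin u' -> A' i = setT) ->
  \bigcap_(i in [set` u]) A i `&` \bigcap_(i in [set` u']) A' i =
  \bigcap_(i in [set i | i \in u ++ u']) (A i `&` A' i).
Proof.
move=> uT uT'; apply/seteqP; split=> [w [uw uw'] i _|w uw].
  split; last by have [/uw'//|/uT' ->] := boolP (i \in u').
  by have [/uw//|/uT ->] := boolP (i \in u).
by split=> i /= iu; have /= [] := uw i; rewrite //= mem_cat iu ?orbT.
Qed.

Lemma cylinderI S : setI_closed (cylinder S).
Proof.
move=> _ _ [u [A [uu FA uS uT ->]]] [u' [A' [uu' FA' uS' uT' ->]]].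
exists (undup (u ++ u')), (fun i => A i `&` A' i); split=> //.
- exact: undup_uniq.
- by move=> i; exact: FI.
- by move=> i; rewrite mem_undup mem_cat => /orP[/uS|/uS'].
- move=> i; rewrite mem_undup mem_cat negb_or => /andP[/uT -> /uT' ->].
  by rewrite setIT.
- rewrite bigcap_seq_catI//; congr bigcap.
  by apply/seteqP; split=> i /=; rewrite mem_undup.
Qed.

Lemma cylinder_indep S S' B B' : S `&` S' = set0 ->
  cylinder S B -> cylinder S' B' -> P (B `&` B') = (P B * P B')%E.
Proof.
move=> SS' [u [A [uu FA uS uT ->]]] [u' [A' [uu' FA' uS' uT' ->]]].
have dis i : i \in u -> i \in u' -> False.
  by move=> /uS Si /uS' S'i; have : (S `&` S') i by []; rewrite SS'.
rewrite bigcap_seq_catI// indF; last 2 first.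
- rewrite cat_uniq uu uu' andbT /=; apply/hasPn => i iu'; apply/negP => iu.
  exact: dis iu iu'.
- by move=> i _; exact: FI.
rewrite big_cat/= indF// indF//; congr (_ * _)%E; apply: eq_big_seq => i iu.
  by rewrite uT' ?setIT//; apply/negP; exact: dis.
by rewrite uT ?setTI//; apply/negP => /dis; exact.
Qed.

(** Disjoint blocks of an independent family generate independent sigma-algebras: cylinders over
    disjoint blocks are independent, and the blocks are enlarged to sigma-algebras one at a time by
    the pi-lambda argument. *)
Lemma mutually_independent_group :
  mutually_independent P (fun n => <<s \bigcup_(i in g @^-1` [set n]) F i >>).
Proof.
pose Fg n := <<s \bigcup_(i in g @^-1` [set n]) F i >>.
have subFg n : Fg n `<=` <<s cylinder (g @^-1` [set n]) >>.
  by apply: sub_sigma_algebra2 => A [i gi FA]; exact: cylinder1 FA.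
have Fgm n : Fg n `<=` measurable.
  apply: smallest_sub; first exact: sigma_algebra_measurable.
  by move=> A [i _]; exact: Fm.
(* The extra cylinder [B] over the blocks outside [s] strengthens the induction: it absorbs a
   cylinder of block [n] while [A n] is not yet a general event. *)
suff H (s : seq J) (A : J -> set T) (B : set T) : uniq s ->
    (forall n, n \in s -> Fg n (A n)) ->
    cylinder (g @^-1` [set n | n \notin s]) B ->
    P (\bigcap_(n in [set` s]) A n `&` B) = (\prod_(n <- s) P (A n) * P B)%E.
  move=> s A us FA; have := H s A setT us FA (cylinderT _).
  by rewrite setIT probability_setT mule1.
elim: s A B => [|n s IH] A B.
  by rewrite set_nil bigcap_set0 big_nil setTI mul1e.
move=> /=/andP[ns us] FA cB.
have FAs m : m \in s -> Fg m (A m) by move=> ms; apply: FA; rewrite inE ms orbT.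
have cBs : cylinder (g @^-1` [set n | n \notin s]) B.
  by apply: sub_cylinder cB => i /=; rewrite inE negb_or => /andP[].
have -> : [set` n :: s] = n |` [set` s].
  by apply/seteqP; split=> m /=; rewrite inE => /predU1P.
rewrite bigcap_setU1.
rewrite big_cons -setIA -[in RHS]muleA -(IH A B us FAs cBs).
apply: (@indep_g_sigma_algebra (cylinder (g @^-1` [set n]))).
- apply: measurableI; last exact: cylinder_measurable cB.
  by apply: fin_bigcap_measurable => // m ms; apply: (Fgm m); exact: FAs.
- exact: cylinder_measurable.
- exact: cylinderI.
(* Since [n] is not in [s], [B] intersected with [E] is again a cylinder over blocks outside [s]. *)
- move=> E cE; rewrite (IH A B us FAs cBs) setIC -setIA IH//; last first.
    apply: cylinderI => //; apply: sub_cylinder cE => i /= ->; exact: ns.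
  rewrite [B `&` E]setIC (@cylinder_indep (g @^-1` [set n]) _ E B _ cE cB).
    by rewrite muleCA.
  by apply/seteqP; split=> // i /= [->]; rewrite inE eqxx.
- by apply: subFg; apply: FA; rewrite mem_head.
Qed.

End grouping.

(** * The two Borel-Cantelli lemmas *)

Lemma borel_cantelli1 (H : nat -> set T) : (forall n, measurable (H n)) ->
  (\sum_(0 <= n <oo) P (H n) < +oo)%E -> {ae P, forall w, ~ lim_sup_set H w}.
Proof.
move=> mH sH; exists (lim_sup_set H); split.
- by apply: bigcapT_measurable => n; exact: bigcup_measurable.
- exact: lim_sup_set_cvg0.
- by move=> w /contrapT.
Qed.

(** If no [D n] with [n >= N] occurs with probability [c > 0], then [c] is at most the product of
    the [1 - p n], hence at most [exp (- sum p n)], so the partial sums are bounded by [- ln c]. The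
    product is over complements, which is why these are required to lie in [F n]. *)
Lemma borel_cantelli2 (F : nat -> set_system T) (D : nat -> set T) :
  mutually_independent P F -> (forall n, measurable (D n)) ->
  (forall n, F n (~` D n)) -> (\sum_(0 <= n <oo) P (D n) = +oo)%E ->
  {ae P, forall w, lim_sup_set D w}.
Proof.
move=> indF mD FD sD.
suff H N : {ae P, forall w, exists2 n, (N <= n)%N & D n w}.
  apply: filterS (ae_foralln H) => w Hw N _.
  by have [n Nn Dn] := Hw N; exists n.
pose p n := fine (P (D n)).
have PDE n : P (D n) = (p n)%:E by rewrite fineK// fin_num_measure.
pose C := \bigcap_(n in [set n | (N <= n)%N]) ~` D n.
have mC : measurable C.
  by apply: bigcap_measurable => [|n _]; [exists N => /=|exact: measurableC].
exists C; split=> //; last first.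
  by move=> w Hw n /= Nn Dn; apply: Hw; exists n.
apply: contrapT => /eqP PC0.
pose c := fine (P C).
have PCE : P C = c%:E by rewrite fineK// fin_num_measure.
have c0 : 0 < c.
  rewrite lt_neqAle -lee_fin -PCE measure_ge0 andbT.
  by apply: contra_neq PC0 => c0; rewrite PCE -c0.
have bound M : \sum_(N <= n < M) p n <= - ln c.
  rewrite lerNr -ler_expR lnK ?posrE// -lee_fin -PCE.
  have sub : C `<=` \bigcap_(n in [set` index_iota N M]) ~` D n.
    by move=> w Cw n /=; rewrite mem_index_iota => /andP[Nn _]; exact: Cw.
  apply: (@le_trans _ _ (P (\bigcap_(n in [set` index_iota N M]) ~` D n))).
    apply: le_measure sub; rewrite inE//.
    by apply: fin_bigcap_measurable => // n _; exact: measurableC.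
  have -> : P (\bigcap_(n in [set` index_iota N M]) ~` D n) =
      (\prod_(n <- index_iota N M) P (~` D n))%E.
    by apply: indF => //; exact: iota_uniq.
  under eq_bigr do rewrite probability_setC// PDE -EFinB.
  rewrite prodEFin lee_fin -sumrN expR_sum; apply: ler_prod => n _.
  by rewrite expR_ge1Dx andbT subr_ge0 -lee_fin -PDE probability_le1.
suff : (\sum_(0 <= n <oo) P (D n) <= (\sum_(0 <= n < N) p n - ln c)%:E)%E.
  by rewrite sD leye_eq.
apply: lime_le; first exact: is_cvg_nneseries.
near=> M; rewrite (eq_bigr (fun n => (p n)%:E)) ?sumEFin ?lee_fin//.
rewrite (@big_cat_nat _ _ _ N)//=; last by near: M; exact: nbhs_infty_ge.
by rewrite lerD2l.
Unshelve. all: by end_near.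
Qed.

End independence.

(** * Arcs of the circle *)

Section circle_lemmas.
Context {R : realType}.
Implicit Types (u v : R) (x y : circle R).

Lemma to_circleP u v : to_circle u = to_circle v <-> u - v \is a Num.int.
Proof.
have H := Quotient.idealrBE (int_subgroup R) u v.
rewrite -[X in _ <-> X]/(is_true (u - v \in int_subgroup R)) H.
by split=> [uv|/eqP]; [apply/eqP|].
Qed.

Lemma reprK_circle x : to_circle (repr x) = x.
Proof. exact: reprK. Qed.

Lemma to_circle_surj x : exists2 u, 0 <= u < 1 & to_circle u = x.
Proof.
exists (repr x - (Num.floor (repr x))%:~R).
  by rewrite subr_ge0 floor_le ltrBlDl -intrD1 floorD1_gt.
rewrite -[RHS]reprK_circle; apply/to_circleP.
by rewrite addrAC subrr add0r rpredN intr_int.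
Qed.

(** The representative of [to_circle u] chosen by [repr] is [u] plus an integer [m], which is
    absorbed into [k]. *)
Lemma arcP u v (l : R) : arc (to_circle u) l (to_circle v) <->
  exists k : int, `|u - v - k%:~R| < l / 2.
Proof.
have /intrP[m hm] : repr (to_circle u) - u \is a Num.int.
  by apply/to_circleP; rewrite reprK_circle.
split=> [[y /= yl /to_circleP/intrP[k hk]]|[k hk]].
- exists (k - m); rewrite rmorphB/= -hk -hm.
  by rewrite (_ : _ - _ = repr (to_circle u) - y)//; ring.
- exists (v + (k + m)%:~R).
    rewrite /ball/= rmorphD/= -hm.
    by rewrite (_ : _ - _ = u - v - k%:~R)//; ring.
  by apply/to_circleP; rewrite addrAC subrr add0r intr_int.
Qed.

(** Turns the condition that a moving arc contains [x] into the condition that its center lies in a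
    fixed open arc around [x]. *)
Lemma arc_sym x y (l : R) : arc x l y <-> arc y l x.
Proof.
rewrite -(reprK_circle x) -(reprK_circle y) !arcP.
have sym (a b : R) (k : int) : `|a - b - k%:~R| = `|b - a - (- k)%:~R|.
  by rewrite -normrN rmorphN/=; congr (`| _ |); ring.
by split=> -[k hk]; exists (- k); rewrite -sym.
Qed.

Lemma to_circle_continuous : continuous (@to_circle R).
Proof. exact: pi_continuous. Qed.

Lemma arc_open x (l : R) : open (arc x l).
Proof.
rewrite /open/= /quotient_open -(reprK_circle x).
rewrite (_ : _ @^-1` _ = \bigcup_(k : int) ball (repr x - k%:~R : R) (l / 2)).
  by apply: bigcup_open => k _; exact: ball_open.
apply/seteqP; split=> v.
- move=> /= /arcP[k hk]; exists k => //; rewrite /ball/=.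
  by rewrite addrAC.
- move=> [k _]; rewrite /ball/= => hk; apply/arcP; exists k.
  by rewrite addrAC.
Qed.

Lemma measurable_open_circle (A : set (circle R)) : open A -> measurable A.
Proof. by move=> oA; exact: sub_sigma_algebra. Qed.

Lemma measurable_arc x (l : R) : measurable (arc x l).
Proof. by apply: measurable_open_circle; exact: arc_open. Qed.

Lemma measurable_to_circle : measurable_fun [set: R] (@to_circle R).
Proof.
apply: (measurability (@open (circle R))) => //.
move=> _ [B oB <-]; rewrite setTI; apply: open_measurable.
by move/continuousP: to_circle_continuous; exact.
Qed.

Lemma uniform_prob01E (A : set R) : measurable A ->
  uniform_prob (@ltr01 R) A = lebesgue_measure (A `&` `[0, 1]).
Proof.
move=> mA; rewrite /uniform_prob integral_uniform_pdf.
rewrite (eq_integral (cst 1%E)); last first.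
  by move=> u; rewrite inE/= in_itv/= /uniform_pdf => -[_ ->]; rewrite subr0 invr1.
by rewrite integral_cst ?mul1e//; exact: measurableI.
Qed.

(** For [l < 1], the part of the unwrapped arc inside [0, 1] is covered by three intervals of length
    [l], the translates by -1, 0 and 1, whence the factor 3. *)
Lemma circle_uniform_arc_le x (l : R) : 0 < l ->
  (circle_uniform (arc x l) <= (3 * l)%:E)%E.
Proof.
move=> l0; have [l1|l1] := leP 1 l.
  apply: (@le_trans _ _ 1%E); last by rewrite lee_fin; lra.
  rewrite /circle_uniform /pushforward; apply: probability_le1.
  rewrite -[X in measurable X]setTI; apply: measurable_to_circle => //.
  exact: measurable_arc.
have mA : measurable (to_circle @^-1` arc x l).
  rewrite -[X in measurable X]setTI; apply: measurable_to_circle => //.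
  exact: measurable_arc.
rewrite /circle_uniform /pushforward uniform_prob01E//.
have [u /andP[u0 u1] ux] := to_circle_surj x.
pose J (k : int) := `[u - k%:~R - l / 2, u - k%:~R + l / 2]%classic.
have JE k : (lebesgue_measure (J k) <= l%:E)%E.
  rewrite lebesgue_measure_itv/= lte_fin ifT; last by lra.
  by rewrite -EFinD lee_fin; lra.
have sub : to_circle @^-1` arc x l `&` `[0, 1] `<=` J (-1) `|` J 0 `|` J 1.
  move=> v [] /=; rewrite -ux in_itv/= => /arcP[k hk] /andP[v0 v1].
  move: hk; rewrite ltr_norml => /andP[k1 k2].
  have : - 2 < k%:~R :> R by lra.
  have : k%:~R < 2 :> R by lra.
  rewrite -[2]/(2%:~R) -mulrNz !ltr_int => k_lt k_gt.
  have : k = -1 \/ k = 0 \/ k = 1 by lia.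
  case=> [|[|]] kE; rewrite kE in k1 k2 *; [left; left|left; right|right];
    by rewrite /J /= in_itv/=; apply/andP; split; lra.
apply: (le_trans (le_measure lebesgue_measure _ _ sub)); rewrite ?inE.
  exact: measurableI.
  by do 2 ?apply: measurableU; exact: measurable_itv.
apply: (le_trans (measureU2 _ _ _)) => //.
  by apply: measurableU; exact: measurable_itv.
  exact: measurable_itv.
rewrite (_ : 3 * l = l + l + l); last by lra.
rewrite 2!EFinD; apply: leeD; last exact: JE.
apply: (le_trans (measureU2 _ _ _)); [exact: measurable_itv..|].
by apply: leeD; exact: JE.
Qed.

(** One half of the arc unwraps to an interval inside [0, 1]: the half to the right of [u] if
    [u <= 1 / 2], the half to its left otherwise. *)
Lemma circle_uniform_arc_ge x (l : R) : 0 < l -> l <= 1 ->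
  ((l / 2)%:E <= circle_uniform (arc x l))%E.
Proof.
move=> l0 l1.
have mA : measurable (to_circle @^-1` arc x l).
  rewrite -[X in measurable X]setTI; apply: measurable_to_circle => //.
  exact: measurable_arc.
rewrite /circle_uniform /pushforward uniform_prob01E//.
have [u /andP[u0 u1] ux] := to_circle_surj x.
have [a [ua0 ua1 a0 a1]] : exists a, [/\ u - l / 2 <= a, a <= u, 0 <= a & a + l / 2 <= 1].
  have [?|?] := leP u (1 / 2); first by exists u; split; lra.
  by exists (u - l / 2); split; lra.
have sub : `]a, a + l / 2[%classic `<=` to_circle @^-1` arc x l `&` `[0, 1].
  move=> v; rewrite /= in_itv/= => /andP[av va]; split.
    rewrite -ux; apply/arcP; exists 0; rewrite subr0 ltr_norml.
    by apply/andP; split; lra.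
  by rewrite in_itv/=; apply/andP; split; lra.
have : lebesgue_measure `]a, a + l / 2[%classic = (l / 2)%:E.
  rewrite lebesgue_measure_itv/= lte_fin ifT; last by lra.
  by rewrite -EFinD; congr EFin; lra.
move=> <-; apply: (le_measure lebesgue_measure _ _ sub); rewrite inE//.
exact: measurableI.
Qed.

End circle_lemmas.

(** * Baire category argument *)

Section baire.
Context {R : realType}.

Lemma lim_sup_set_baire (A : nat -> set R) :
  (forall p q : rat, 0 <= (ratr p : R) -> (ratr q : R) <= 1 -> p < q ->
    forall N, exists2 n, (N <= n)%N &
      (interior (A n) `&` `]ratr p, ratr q[ !=set0)) ->
  exists2 t, t \in `[0, 1] & lim_sup_set A t.
Proof.
move=> HA.
(* Adding the complement of [0, 1] makes [F N] dense in the whole line, where Baire's theorem is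
   applied. *)
pose F N := ~` `[0, 1]%classic `|` \bigcup_(n in [set n | (N <= n)%N]) (A n)°.
have Fo N : open (F N).
  apply: openU; first by apply: closed_openC; exact: itv_closed.
  by apply: bigcup_open => n _; exact: open_interior.
have Fd N : dense (F N).
  move=> O [t Ot] oO.
  have [[s [Os s01]]|OI] := pselect (exists s, O s /\ ~ (s \in `[0, 1])).
    by exists s; split => //; left.
  have O01 s : O s -> s \in `[0, 1].
    by move=> Os; apply: contrapT => s01; apply: OI; exists s.
  (* Now [O] lies inside [0, 1]. Rationals [p < t < q] near [t] belong to [O], so they are
     admissible window ends. *)
  have /nbhs_ballP[e /= e0 eO] : nbhs t O by exact: open_nbhs_nbhs.
  have [p] := @rat_in_itvoo R (t - e) t ltac:(lra).
  rewrite in_itv/= => /andP[p1 p2].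
  have [q] := @rat_in_itvoo R t (t + e) ltac:(lra).
  rewrite in_itv/= => /andP[q1 q2].
  have pqO : `]ratr p, ratr q[ `<=` O.
    move=> s; rewrite /= in_itv/= => /andP[ps sq]; apply: eO.
    by rewrite /ball/= ltr_norml; apply/andP; split; lra.
  have pq : p < q by rewrite -(ltr_rat R); lra.
  have Op : O (ratr p) by apply: eO; rewrite /ball/= ltr_norml; apply/andP; split; lra.
  have Oq : O (ratr q) by apply: eO; rewrite /ball/= ltr_norml; apply/andP; split; lra.
  have := O01 _ Op; rewrite in_itv/= => /andP[p0 _].
  have := O01 _ Oq; rewrite in_itv/= => /andP[_ q1'].
  have [n Nn [s [As spq]]] := HA p q p0 q1' pq N.
  exists s; split; first exact: pqO.
  by right; exists n.
have [t [t01 Ft]] : `]0, 1[ `&` \bigcap_N F N !=set0.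
  have dF := @Baire R R^o F (fun i => conj (Fo i) (Fd i)).
  apply: dF; first by exists (1 / 2); rewrite /= in_itv/=; apply/andP; split; lra.
  exact: (@itv_open _ R 0 1).
have t01' : t \in `[0, 1].
  by move: t01; rewrite /= !in_itv/= => /andP[? ?]; apply/andP; split; lra.
exists t => // N _; have [//|[n Nn An]] := Ft N I.
by exists n => //; exact: interior_subset.
Qed.

End baire.

Lemma ae_forall_countable d (T : measurableType d) (R : realType)
    (P : {measure set T -> \bar R}) (I : countType) (Q : I -> T -> Prop) :
  (forall i, {ae P, forall w, Q i w}) -> {ae P, forall w, forall i, Q i w}.
Proof.
move=> HQ.
have : {ae P, forall w, forall n : nat, if unpickle n is Some i then Q i w else True}.
  apply: ae_foralln => n; case: unpickle => [i|]; first exact: HQ.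
  exact: aeW.
by apply: filterS => w Hw i; have := Hw (pickle i); rewrite pickleK.
Qed.

(** The reduction shared by both models: there are countably many rational windows, so each may be
    treated almost surely and separately before Baire is applied path by path. *)
Lemma ae_covering_times d (T : measurableType d) (R : realType)
    (P : {measure set T -> \bar R}) (l : nat -> R)
    (U : nat -> R -> T -> circle R) (x : circle R) :
  (forall p q : rat, 0 <= (ratr p : R) -> (ratr q : R) <= 1 -> p < q ->
    {ae P, forall w, forall N, exists2 n, (N <= n)%N &
      [set t | arc (U n t w) (l n) x]° `&` `]ratr p, ratr q[ !=set0}) ->
  {ae P, forall w, covering_times l U x w != set0}.
Proof.
move=> H.
have : {ae P, forall w (pq : rat * rat), 0 <= (ratr pq.1 : R) ->
    (ratr pq.2 : R) <= 1 -> pq.1 < pq.2 -> forall N, exists2 n, (N <= n)%N &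
    [set t | arc (U n t w) (l n) x]° `&` `]ratr pq.1, ratr pq.2[ !=set0}.
  apply: ae_forall_countable => -[p q] /=.
  have [p0|?] := boolP (0 <= (ratr p : R)); last exact: aeW.
  have [q1|?] := boolP ((ratr q : R) <= 1); last exact: aeW.
  have [pq|?] := boolP (p < q); last exact: aeW.
  exact: filterS (H p q p0 q1 pq).
apply: filterS => w Hw.
have [t t01 At] := lim_sup_set_baire (fun p q => Hw (p, q)).
by apply/set0P; exists t; split.
Qed.

(** * Brownian model *)

Lemma countable_bigcup_measurable d (T : sigmaRingType d) (I : countType)
    (D : set I) (F : I -> set T) :
  (forall i, D i -> measurable (F i)) -> measurable (\bigcup_(i in D) F i).
Proof.
move=> mF; rewrite bigcup_mkcond; apply: countable_bigcupT_measurable => //.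
by move=> i; case: ifPn => [|_]; [rewrite inE; exact: mF|exact: measurable0].
Qed.

Lemma nneseries_ge_cst (R : realType) (u : nat -> \bar R) (c : R) :
  0 < c -> (forall n, (c%:E <= u n)%E) -> (\sum_(0 <= n <oo) u n = +oo)%E.
Proof.
move=> c0 cu; have u0 n : (0 <= u n)%E.
  by apply: le_trans (cu n); rewrite lee_fin ltW.
apply/eqP; rewrite -leye_eq leNgt; apply/negP => sy.
have s_fin : (\sum_(0 <= n <oo) u n)%E \is a fin_num.
  by rewrite ge0_fin_numE// nneseries_ge0.
pose n := (Num.truncn (fine (\sum_(0 <= n <oo) u n)%E / c)).+1.
have : (\sum_(0 <= k < n) c%:E <= \sum_(0 <= n <oo) u n)%E.
  apply: le_trans (nneseries_lim_ge n _) => //.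
  by apply: lee_sum => k _.
rewrite -[leRHS]fineK// sumEFin lee_fin big_const_nat subn0 iter_addr_0.
apply/negP; rewrite -ltNge -mulr_natl -ltr_pdivrMr//.
exact: truncnS_gt.
Qed.

(** On ]1, 2[ the centered normal density is at least its value at 2. *)
Lemma normal_prob_itv_gt0 (R : realType) (s : R) : s != 0 ->
  (0 < normal_prob 0 s `]1%R, 2%R[)%E.
Proof.
move=> s0; pose c := normal_pdf 0 s 2.
have c0 : 0 < c.
  by rewrite /c normal_pdfE// mulr_gt0// ?normal_peak_gt0// expR_gt0.
apply: (@lt_le_trans _ _ (\int[lebesgue_measure]_(x in `]1%R, 2%R[) c%:E)%E).
  rewrite integral_cst//= lebesgue_measure_itv/= lte_fin ifT; last by lra.
  by rewrite -EFinD mule_gt0 ?lte_fin//; lra.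
apply: ge0_le_integral => //=.
- by move=> x _; rewrite lee_fin ltW.
- apply/measurable_EFinP; apply: measurable_funTS; exact: measurable_normal_pdf.
- move=> x; rewrite in_itv/= => /andP[x1 x2]; rewrite lee_fin /c !normal_pdfE//.
  rewrite ler_wpM2l ?normal_peak_ge0// /normal_fun ler_expR.
  rewrite !subr0 !mulNr lerN2 ler_wpM2r ?invr_ge0 ?mulrn_wge0 ?sqr_ge0//.
  by rewrite ler_pXn2r ?nnegrE//; lra.
Qed.

Section brownian.
Context {d : measure_display} {T : measurableType d} {R : realType}.
Variables (P : probability T R) (U : R -> T -> circle R) (B : R -> T -> R).
Hypothesis BM : brownian_motion P B.
Hypothesis UB : forall t w, 0 <= t -> U t w = to_circle (B t w).
Variables (x : circle R) (l : R).
Hypothesis l0 : 0 < l.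

Lemma brownian_continuous w t : 0 < t -> {for t, continuous (B ^~ w)}.
Proof.
move=> t0; have [_ /(_ w) Bc _ _] := BM.
have : {within `]0, +oo[%classic, continuous (B ^~ w)}.
  apply: continuous_subspaceW Bc => s /=; rewrite in_itv/= andbT; exact: ltW.
rewrite continuous_open_subspace//.
by apply; rewrite inE/= in_itv/= andbT.
Qed.

Lemma arc_times_interior w t : 0 < t -> arc x l (U t w) ->
  ([set s | arc (U s w) l x])° t.
Proof.
move=> t0; rewrite UB ?ltW// => xt.
have : \forall s \near t, arc x l (to_circle (B s w)).
  have ct : {for t, continuous (to_circle \o B ^~ w)}.
    apply: continuous_comp; first exact: brownian_continuous.
    exact: to_circle_continuous.
  by apply: ct; apply: open_nbhs_nbhs; split=> //; exact: arc_open.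
have : \forall s \near t, 0 < s by exact: lt_nbhsr.
by apply: filterS2 => s s0 xs /=; apply/arc_sym; rewrite UB// ltW.
Qed.

(** Rational times make this a countable union, hence an event of the process; by continuity, a hit
    of the open arc at a real time of ]a, b[ yields one at a rational time. *)
Definition hit (a b : R) : set T :=
  \bigcup_(q in [set q : rat | a < ratr q < b]) U (ratr q) @^-1` arc x l.

Lemma hit_sigma a b : 0 <= a -> sigma_of_process U (hit a b).
Proof.
move=> a0.
apply: (@countable_bigcup_measurable _ (g_sigma_algebraType _)) => //.
move=> q /= /andP[aq qb].
apply: sub_sigma_algebra; exists (ratr q) => //=; first by lra.
exists (arc x l); first exact: measurable_arc.
by rewrite setTI.
Qed.

Lemma sub_hit a b w : 0 <= a -> a < b -> 1 < B b w - B a w -> hit a b w.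
Proof.
(* [v + k] is the first lift of [x] above [B a w]; it exceeds [B a w] by at most 1, hence lies below
   [B b w]. *)
move=> a0 ab B1; pose v := repr x; pose k := Num.floor (B a w - v) + 1.
have k1 : B a w < v + k%:~R.
  by rewrite -ltrBlDl; exact: lt_succ_floor.
have k2 : v + k%:~R < B b w.
  have : (Num.floor (B a w - v))%:~R <= B a w - v by exact: floor_le.
  by rewrite /k rmorphD/=; lra.
have [_ /(_ w) Bc _ _] := BM.
have Bab : {within `[a, b], continuous (B ^~ w)}.
  apply: continuous_subspaceW Bc => s /=; rewrite in_itv/= => /andP[].
  by move=> /(le_trans a0).
have vk : Num.min (B a w) (B b w) <= v + k%:~R <= Num.max (B a w) (B b w).
  by rewrite ge_min le_max; apply/andP; split; apply/orP; [left|right]; lra.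
have [c] := IVT (ltW ab) Bab vk.
rewrite in_itv/= => /andP[ac cb] Bcv.
(* The crossing time is strictly inside the window, which leaves room for a rational time just to
   its right. *)
have {}ac : a < c.
  by rewrite lt_neqAle ac andbT; apply: contraTneq k1 => ->; rewrite Bcv; lra.
have {}cb : c < b.
  by rewrite lt_neqAle cb andbT; apply: contraTneq k2 => <-; rewrite Bcv; lra.
have c0 : 0 < c by lra.
have : nbhs c [set s | arc (U s w) l x].
  apply: arc_times_interior => //; rewrite UB ?ltW// Bcv.
  rewrite -(reprK_circle x) -/v; apply/arcP; exists (- k).
  rewrite rmorphN/= (_ : v - (v + k%:~R) - - k%:~R = 0); last by ring.
  by rewrite normr0 divr_gt0.
move=> /nbhs_ballP[e /= e0 He].
have cbe : c < Num.min b (c + e) by rewrite lt_min cb ltrDl.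
have [q] := rat_in_itvoo cbe.
rewrite in_itv/= lt_min => /and3P[cq qb qe].
exists q => /=; first by apply/andP; split; lra.
apply/arc_sym; apply: He; rewrite /ball/= ltr_norml; apply/andP; split; lra.
Qed.

(** The bound depends on [b - a] only, so it is the same for all the Brownian motions and the sum
    over [n] diverges whatever the arc lengths. *)
Lemma hit_prob_ge a b : 0 <= a -> a < b ->
  (normal_prob 0 (Num.sqrt (b - a)) `]1%R, 2%R[ <= P (hit a b))%E.
Proof.
move=> a0 ab; have [Bm _ /(_ a b a0 ab)[mD Bd] _] := BM.
rewrite -(Bd `]1%R, 2%R[%classic)// /pushforward; apply: le_measure.
- rewrite inE -[X in measurable X]setTI; exact: mD.
- rewrite inE; apply: countable_bigcup_measurable => // q /= /andP[aq qb].
  rewrite (_ : U _ = to_circle \o B (ratr q)); last first.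
    by apply/funext => w /=; rewrite UB//; lra.
  rewrite -[X in measurable X]setTI; apply: measurableT_comp => //.
  + exact: measurable_to_circle.
  + by apply: Bm; lra.
  + exact: measurable_arc.
- by move=> w /=; rewrite in_itv/= => /andP[B1 _]; exact: sub_hit.
Qed.

End brownian.

Lemma brownian_covering_times d (T : measurableType d) (R : realType)
    (P : probability T R) (l : nat -> R) (x : circle R)
    (U : nat -> R -> T -> circle R) :
  (forall n, 0 < l n) -> brownian_model P U ->
  {ae P, forall w, covering_times l U x w != set0}.
Proof.
move=> l0 [BU indU].
have /choice[B /all_and2[BM UB]] n : exists Bn, brownian_motion P Bn /\
    forall t w, 0 <= t -> U n t w = to_circle (Bn t w) by have [] := BU n.
apply: ae_covering_times => p q p0 q1 pq.
have pq' : (ratr p : R) < ratr q by rewrite ltr_rat.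
pose D n := hit (U n) x (l n) (ratr p) (ratr q).
have DS n : sigma_of_process (U n) (D n) by exact: hit_sigma.
have sub n : sigma_of_process (U n) `<=` measurable.
  apply: smallest_sub; first exact: sigma_algebra_measurable.
  move=> _ [t t0 [C mC <-]].
  rewrite (_ : U n t = to_circle \o B n t); last first.
    by apply/funext => w /=; rewrite UB.
  apply: (measurableT_comp measurable_to_circle) => //.
  by have [+ _ _ _] := BM n; exact.
have : {ae P, forall w, lim_sup_set D w}.
  apply: (borel_cantelli2 indU).
  - by move=> n; exact: sub.
  - by move=> n; apply: g_sigma_algebraC; exact: DS.
  - have s0 : 0 < Num.sqrt (ratr q - ratr p : R) by rewrite sqrtr_gt0 subr_gt0.
    have := normal_prob_itv_gt0 (lt0r_neq0 s0).
    set c := normal_prob _ _ _ => c0.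
    have cE : c = (fine c)%:E by rewrite fineK// fin_num_measure.
    apply: (@nneseries_ge_cst _ _ (fine c)); first by rewrite -lte_fin -cE.
    by move=> n; rewrite -cE; apply: (hit_prob_ge (BM n) (UB n)).
apply: filterS => w Hw N; have [n /= Nn [r /= /andP[pr rq] xr]] := Hw N I.
exists n => //; exists (ratr r); split; last by rewrite /= in_itv/= pr.
by apply: (arc_times_interior (BM n) (UB n)) => //; lra.
Qed.

(** * Sums of independent exponential variables *)

Lemma nneseries_geometric_le (R : realType) (u : nat -> \bar R) (a q : R) :
  0 <= a -> 0 < q -> q < 1 -> (forall n, (0 <= u n <= (a * q ^+ n)%:E)%E) ->
  (\sum_(0 <= n <oo) u n <= (a / (1 - q))%:E)%E.
Proof.
move=> a0 q0 q1 hu.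
apply: lime_le; first by apply: is_cvg_nneseries => n _ _; have /andP[] := hu n.
near=> n; apply: (@le_trans _ _ (series (geometric a q) n)%:E); last first.
  by rewrite lee_fin geometric_le_lim// ger0_norm// ltW.
rewrite /series/= -sumEFin; apply: lee_sum => k _.
by have /andP[] := hu k.
Unshelve. all: by end_near.
Qed.

Lemma nneseries_lt_near (R : realType) (u : nat -> \bar R) (k : R) : 0 < k ->
  (forall n, (0 <= u n)%E) -> (\sum_(0 <= n <oo) u n < +oo)%E ->
  \forall n \near \oo, (u n < k%:E)%E.
Proof.
move=> k0 u0 su.
have /fine_cvgP[_ /cvgrPdist_lt /(_ _ k0)] := nneseries_tail_cvg su (fun n _ => u0 n).
apply: filterS => n /=; rewrite sub0r normrN => tk.
have ut : (u n <= \sum_(n <= i <oo) u i)%E.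
  apply: le_trans (nneseries_lim_ge n.+1 _) => //.
  by rewrite big_nat1.
have tfin : (\sum_(n <= i <oo) u i)%E \is a fin_num.
  rewrite ge0_fin_numE ?nneseries_ge0//; apply: le_lt_trans su.
  by rewrite [leRHS](@nneseries_split _ _ 0 n)// add0n leeDr// sume_ge0.
apply: le_lt_trans ut _; rewrite -(fineK tfin) lte_fin.
by apply: le_lt_trans tk; exact: ler_norm.
Qed.

(** If the sum of [u] were finite, then eventually [u n < k], so the minimum would be [k * v n] and
    the sum of [v] would be finite too. *)
Lemma nneseries_min_pinfty (R : realType) (u : nat -> \bar R) (v : nat -> R)
    (k : R) (N : nat) : 0 < k -> (forall n, (0 <= u n)%E) ->
  (forall n, 0 <= v n) ->
  (forall n, (N <= n)%N -> ((Num.min k (k * v n))%:E <= u n)%E) ->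
  (\sum_(0 <= n <oo) (v n)%:E = +oo)%E -> (\sum_(0 <= n <oo) u n = +oo)%E.
Proof.
move=> k0 u0 v0 huv sv; apply/eqP; rewrite -leye_eq leNgt; apply/negP => su.
have s_fin : (\sum_(0 <= n <oo) u n)%E \is a fin_num.
  by rewrite ge0_fin_numE// nneseries_ge0.
have [M _ HM] : \forall n \near \oo, (u n < k%:E)%E.
  exact: nneseries_lt_near.
pose M' := maxn M N.
suff : (\sum_(0 <= n <oo) (v n)%:E <= (\sum_(0 <= n < M') v n +
    k^-1 * fine (\sum_(0 <= n <oo) u n)%E)%:E)%E by rewrite sv leye_eq.
apply: lime_le; first by apply: is_cvg_nneseries => n _ _; rewrite lee_fin.
near=> m; rewrite sumEFin lee_fin (@big_cat_nat _ _ _ M')//=; last first.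
  by near: m; exact: nbhs_infty_ge.
rewrite lerD2l mulrC ler_pdivlMr// -lee_fin fineK//.
apply: (@le_trans _ _ (\sum_(0 <= n < m) u n)%E); last exact: nneseries_lim_ge.
apply: (@le_trans _ _ (\sum_(M' <= n < m) u n)%E).
  rewrite mulrC mulr_sumr -sumEFin [leLHS]big_nat_cond [leRHS]big_nat_cond.
  apply: lee_sum => n /andP[/andP[Mn _] _].
  move: Mn; rewrite geq_max => /andP[Mn Nn].
  have := huv _ Nn; rewrite minEle; case: ifPn => // _ ku.
  by have := HM _ Mn; rewrite ltNge ku.
rewrite [leRHS](@big_cat_nat _ _ _ M')//=; last by near: m; exact: nbhs_infty_ge.
by rewrite leeDr// sume_ge0.
Unshelve. all: by end_near.
Qed.

Section exponential_law.
Context {R : realType}.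
Variable r : R.
Hypothesis r0 : 0 < r.

Lemma exponential_prob_le0 : exponential_prob r `]-oo, 0%R] = 0%E.
Proof.
rewrite /exponential_prob -integral_itv_bndo_bndc; last first.
  apply/measurable_EFinP; apply: measurable_funTS.
  exact: measurable_exponential_pdf.
apply: integral0_eq => x /=; rewrite in_itv/= => x0.
by rewrite lt0_exponential_pdf.
Qed.

Lemma exponential_prob_gt t : 0 <= t ->
  exponential_prob r `]t, +oo[ = (expR (- r * t))%:E.
Proof.
move=> t0.
have E s : exponential_prob r `]s, +oo[ = (1 - exponential_prob r `]-oo, s])%E.
  rewrite -setCitvl probability_setC//; exact: measurable_itv.
rewrite E; move: t0; rewrite le_eqVlt => /predU1P[<-|t0].
  by rewrite exponential_prob_le0 mulr0 expR0 sube0.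
have -> : `]-oo, t]%classic = `]-oo, 0]%classic `|` `]0, t]%classic :> set R.
  by apply/seteqP; split=> x /=; rewrite !in_itv/=; lra.
have tE : exponential_prob r `]0%R, t] = (1 - (expR (- r * t))%:E)%E.
  rewrite -exponential_prob_itv0c// /exponential_prob integral_itv_obnd_cbnd//.
  apply/measurable_EFinP; apply: measurable_funTS.
  exact: measurable_exponential_pdf.
rewrite measureU//=; last first.
  by apply/seteqP; split=> x //=; rewrite !in_itv/=; lra.
rewrite [X in (_ - (X + _))%E]exponential_prob_le0 [X in (_ - (_ + X))%E]tE.
set e := expR _; have -> : (1 - (0 + (1 - e%:E)))%E = (1 - (0 + (1 - e)))%:E by [].
by congr EFin; ring.
Qed.

End exponential_law.

Section expectation_prod.
Context {d : measure_display} {T : measurableType d} {R : realType}.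
Variables (P : probability T R) (X Y : {RV P >-> R}).
Hypotheses (X0 : forall w, 0 <= X w) (Y0 : forall w, 0 <= Y w).
Hypothesis indXY : forall A B : set R, measurable A -> measurable B ->
  P (X @^-1` A `&` Y @^-1` B) = (P (X @^-1` A) * P (Y @^-1` B))%E.

(** By uniqueness of product measures the joint law is the product of the laws, and Tonelli's
    theorem applies. *)
Lemma ge0_expectation_prod : ('E_P[X \* Y] = 'E_P[X] * 'E_P[Y])%E.
Proof.
have mXY : measurable_fun setT (fun w => (X w, Y w)).
  exact: measurable_fun_pair.
pose XY : {RV P >-> (R * R)%type} := mfun_Sub (mem_set mXY).
(* The absolute values make the integrand nonnegative on the whole plane without changing it on the
   range of [(X, Y)]. *)
pose f (z : R * R) : \bar R := (`|z.1|%:E * `|z.2|%:E)%E.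
have mf : measurable_fun setT f.
  apply: emeasurable_funM; apply/measurable_EFinP.
    by apply: measurableT_comp => //; exact: measurable_fst.
  by apply: measurableT_comp => //; exact: measurable_snd.
have f0 z : (0 <= f z)%E by rewrite /f -EFinM lee_fin mulr_ge0.
have -> : ('E_P[X \* Y] = \int[P]_w (f \o XY) w)%E.
  rewrite unlock; apply: eq_integral => w _ /=.
  by rewrite /f /= !ger0_norm.
rewrite -ge0_integral_distribution//.
transitivity (\int[distribution P X \x distribution P Y]_z f z)%E.
  apply: eq_measure_integral => A mA _; apply/esym.
  by apply: product_measure_unique => // B C mB mC; exact: indXY.
rewrite fubini_tonelli1//.
have mabs : measurable_fun setT (fun z : R => `|z|%:E).
  by apply/measurable_EFinP; exact: normr_measurable.
have normE (Z : {RV P >-> R}) : (forall w, 0 <= Z w) ->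
    (\int[distribution P Z]_z `|z|%:E = 'E_P[Z])%E.
  move=> Z0; rewrite ge0_integral_distribution//.
  by rewrite unlock; apply: eq_integral => w _ /=; rewrite ger0_norm.
rewrite /fubini_F /f /=.
under eq_integral => z _.
  rewrite ge0_integralZl_EFin//.
  rewrite normE//.
  over.
rewrite ge0_integralZr//.
- by rewrite normE.
- exact: expectation_ge0.
Qed.

End expectation_prod.

Lemma Lfun2_sqr_integrable d (T : measurableType d) (R : realType)
    (P : {measure set T -> \bar R}) (f : T -> R) : measurable_fun setT f ->
  (\int[P]_w (f w ^+ 2)%:E < +oo)%E -> f \in Lfun P 2%:E.
Proof.
move=> mf fi; rewrite inE; apply/andP; split; first exact: mem_set.
rewrite inE/= /finite_norm unlock /= poweR_lty//.
apply: le_lt_trans fi; rewrite le_eqVlt; apply/orP; left; apply/eqP.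
apply: eq_integral => w _ /=; rewrite -[2]/(2%:R) powR_mulrn//.
by rewrite real_normK ?num_real.
Qed.

(* sum of 4 * exp (- n / 2), a bound for the second moment of the exponential law
   of rate 1 *)
Definition moment_const {R : realType} : R := 4 / (1 - expR (- 2^-1)).

Lemma moment_const_gt0 (R : realType) : 0 < moment_const :> R.
Proof. by rewrite divr_gt0// subr_gt0 expR_lt1 oppr_lt0 invr_gt0. Qed.

Section exponential_sums.
Context {d : measure_display} {T : measurableType d} {R : realType}.
Variables (P : probability T R) (r : R) (Z : nat -> {RV P >-> R}).
Hypotheses (r0 : 0 < r) (Z0 : forall k w, 0 <= Z k w).
Hypothesis Zgt : forall k t, 0 <= t ->
  P (Z k @^-1` `]t, +oo[) = (expR (- r * t))%:E.
Hypothesis Zind : forall j k, j != k -> forall A B : set R,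
  measurable A -> measurable B ->
  P (Z j @^-1` A `&` Z k @^-1` B) = (P (Z j @^-1` A) * P (Z k @^-1` B))%E.

(** The expectation is the integral of the tail [exp (- r t)], which is [r^-1] times the exponential
    density. *)
Lemma expectation_exponential k : ('E_P[Z k] = (r^-1)%:E)%E.
Proof.
rewrite ge0_expectation_ccdf//.
transitivity (\int[lebesgue_measure]_(t in `[0%R, +oo[)
    ((r^-1)%:E * (exponential_pdf r t)%:E))%E.
  apply: eq_integral => t; rewrite inE/= in_itv/= andbT => t0.
  rewrite /ccdf /distribution /pushforward Zgt// exponential_pdfE//.
  by rewrite -EFinM mulKf// gt_eqF.
have mpdf : measurable_fun setT (fun t => (exponential_pdf r t)%:E).
  by apply/measurable_EFinP; exact: measurable_exponential_pdf.
rewrite ge0_integralZl_EFin//; last 3 first.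
- by move=> t _; rewrite lee_fin exponential_pdf_ge0 ?ltW.
- exact: measurable_funTS.
- by rewrite invr_ge0 ltW.
rewrite -[RHS]mule1 -(integral_exponential_pdf r0) [in RHS]integral_mkcond.
rewrite [in LHS]integral_mkcond; congr (_ * _)%E; apply: eq_integral => t _.
rewrite !patchE in_setT; case: ifPn => // /negP t0.
rewrite lt0_exponential_pdf// ltNge; apply/negP => t1; apply: t0.
by rewrite inE/= in_itv/= t1.
Qed.

(** A discrete layer-cake bound: [(r Z)^2] is at most the sum of [2 n + 1] over the [n < r Z], and
    [r Z > n] has probability [exp (- n)]. *)
Lemma second_moment_exponential k :
  (\int[P]_w (Z k w ^+ 2)%:E <= (moment_const / r ^+ 2)%:E)%E.
Proof.
pose c n : R := (n.*2.+1)%:R / r ^+ 2.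
have c0 n : 0 <= c n by rewrite divr_ge0 ?sqr_ge0.
pose A n : set T := Z k @^-1` `]n%:R / r, +oo[.
have mA n : measurable (A n).
  rewrite -[A n]setTI; apply: measurable_funP => //; exact: measurable_itv.
pose u n w : \bar R := (c n * \1_(A n) w)%:E.
have u0 n w : (0 <= u n w)%E by rewrite lee_fin mulr_ge0.
have mu n : measurable_fun setT (u n).
  by apply/measurable_EFinP; apply: measurable_funM => //; exact: measurable_indic.
(* the first odd numbers sum to squares *)
have Zu w : ((Z k w ^+ 2)%:E <= \sum_(0 <= n <oo) u n w)%E.
  have rZ0 : 0 <= r * Z k w by rewrite mulr_ge0// ltW.
  pose N := Num.truncn (r * Z k w).
  have /andP[N1 N2] := truncn_itv rZ0.
  have sumc m : \sum_(0 <= n < m) c n = m%:R ^+ 2 / r ^+ 2.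
    elim: m => [|m IHm]; first by rewrite big_geq// expr0n/= mul0r.
    rewrite big_nat_recr//= IHm -mulrDl; congr (_ / _).
    by rewrite -!natrX -natrD; congr (_%:R); lia.
  apply: (@le_trans _ _ (\sum_(0 <= n < N) u n w + u N w)%E); last first.
    rewrite -(@big_nat_recr _ _ _ N 0 (fun n => u n w))//.
    exact: nneseries_lim_ge.
  have uA n : n%:R < r * Z k w -> u n w = (c n)%:E.
    move=> nZ; rewrite /u indicE mem_set ?mulr1// /A /= in_itv/= andbT.
    by rewrite ltr_pdivrMr// mulrC.
  rewrite (eq_big_nat _ _ (F2 := fun n => (c n)%:E)); last first.
    move=> n /andP[_ nN]; apply: uA; apply: lt_le_trans N1.
    by rewrite ltr_nat.
  (* If [r Z] is the integer [N], then [A N] fails because it is strict, but the first [N] terms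
     already give the square exactly. *)
  rewrite sumEFin sumc; move: N1; rewrite le_eqVlt => /predU1P[NE|N1].
    rewrite NE exprMn mulrAC divff ?mul1r ?leeDl//.
    by rewrite sqrf_eq0 gt_eqF.
  rewrite uA// -EFinD lee_fin.
  have -> : N%:R ^+ 2 / r ^+ 2 + c N = N.+1%:R ^+ 2 / r ^+ 2.
    by rewrite -!sumc big_nat_recr.
  rewrite ler_pdivlMr ?exprn_gt0// mulrC -exprMn ler_pXn2r// ?nnegrE//.
  exact: ltW.
have mZ : measurable_fun setT (fun w => (Z k w ^+ 2)%:E).
  by apply/measurable_EFinP; exact: measurable_funX.
apply: (@le_trans _ _ (\int[P]_w \sum_(0 <= n <oo) u n w)%E).
  apply: ge0_le_integral => //.
  - by move=> w _; rewrite lee_fin sqr_ge0.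
  - exact: ge0_emeasurable_sum.
rewrite integral_nneseries//.
rewrite /moment_const mulrAC; apply: nneseries_geometric_le => //.
  by rewrite divr_ge0 ?sqr_ge0.
move=> n; rewrite integral_ge0//=.
under eq_integral do rewrite /u EFinM.
rewrite ge0_integralZl_EFin//; last first.
  by apply/measurable_EFinP; exact: measurable_indic.
have -> : (\int[P]_w (\1_(A n) w)%:E = (expR (- n%:R))%:E)%E.
  rewrite integral_indic// setIT; apply: (etrans (Zgt k _)).
    by rewrite divr_ge0 ?(ltW r0).
  by rewrite mulNr mulrCA divff ?mulr1// gt_eqF.
rewrite -EFinM lee_fin /c -expRM_natl mulrAC [leRHS]mulrAC.
rewrite ler_wpM2r ?invr_ge0 ?sqr_ge0//.
(* One factor [exp (- n / 2)] is kept for the geometric series; the other absorbs the weight, as [2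
   n + 1 <= 4 (1 + n / 2) <= 4 exp (n / 2)]. *)
have -> : expR (- n%:R : R) = expR (n%:R * - 2^-1) * expR (n%:R * - 2^-1).
  by rewrite -expRD; congr expR; field.
rewrite mulrA ler_wpM2r ?expR_ge0//.
rewrite mulrN expRN ler_pdivrMr ?expR_gt0//.
have := expR_ge1Dx (n%:R * 2^-1 : R).
have -> : (n.*2.+1)%:R = 2 * n%:R + 1 :> R by rewrite -muln2 -addn1 natrD natrM mulrC.
by lra.
Qed.

Lemma Lfun2_exponential k : (Z k : T -> R) \in Lfun P 2%:E.
Proof.
apply: Lfun2_sqr_integrable => //.
exact: le_lt_trans (second_moment_exponential k) (ltry _).
Qed.

Let Lfun1 (X : T -> R) : X \in Lfun P 2%:E -> X \in Lfun P 1.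
Proof. by apply: Lfun_subset12; exact: fin_num_measure. Qed.

Lemma covariance_exponential j k : j != k -> covariance P (Z j) (Z k) = 0%E.
Proof.
move=> jk; rewrite covarianceE.
- rewrite [X in (X - _)%E](ge0_expectation_prod (Z0 j) (Z0 k) (Zind jk)).
  by rewrite subee// !expectation_exponential.
- exact/Lfun1/Lfun2_exponential.
- exact/Lfun1/Lfun2_exponential.
- by apply: Lfun2_mul_Lfun1; exact: Lfun2_exponential.
Qed.

Lemma variance_exponential_le k : ('V_P[Z k] <= (moment_const / r ^+ 2)%:E)%E.
Proof.
rewrite varianceE; last exact: Lfun2_exponential.
apply: le_trans (second_moment_exponential k).
rewrite [X in (X - _ <= _)%E](_ : _ = \int[P]_w (Z k w ^+ 2)%:E)%E; last first.
  by rewrite unlock.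
apply: (@le_trans _ _ (\int[P]_w (Z k w ^+ 2)%:E - 0)%E); last by rewrite sube0.
apply: leeB => //.
by rewrite expectation_exponential -EFin_expe lee_fin sqr_ge0.
Qed.

Definition exponential_sum (J : nat) : T -> R := fun w => \sum_(k < J) Z k w.

Lemma exponential_sumS J :
  exponential_sum J.+1 = exponential_sum J \+ Z J.
Proof. by apply/funext => w; rewrite /exponential_sum big_ord_recr. Qed.

Lemma exponential_sum0 : exponential_sum 0 = cst 0.
Proof. by apply/funext => w; rewrite /exponential_sum big_ord0. Qed.

Lemma measurable_exponential_sum J : measurable_fun setT (exponential_sum J).
Proof. exact: measurable_sum. Qed.

Lemma Lfun2_exponential_sum J : exponential_sum J \in Lfun P 2%:E.
Proof.
elim: J => [|J IH]; first by rewrite exponential_sum0 Lfun_cst.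
rewrite exponential_sumS.
have /(@Lfun_addr_closed _ _ _ P)[_] : (1 <= 2%:E :> \bar R)%E by rewrite lee_fin; lra.
by apply; [exact: IH|exact: Lfun2_exponential].
Qed.

Lemma expectation_exponential_sum J :
  ('E_P[exponential_sum J] = (J%:R / r)%:E)%E.
Proof.
elim: J => [|J IH]; first by rewrite exponential_sum0 expectation_cst mul0r.
rewrite exponential_sumS expectationD; last 2 first.
- exact/Lfun1/Lfun2_exponential_sum.
- exact/Lfun1/Lfun2_exponential.
by rewrite IH expectation_exponential -EFinD -[J.+1]addn1 natrD mulrDl mul1r.
Qed.

Lemma covariance_exponential_sum J k : (J <= k)%N ->
  covariance P (exponential_sum J) (Z k) = 0%E.
Proof.
elim: J => [|J IH] Jk; first by rewrite exponential_sum0 covariance_cst_l.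
rewrite exponential_sumS covarianceDl.
- by rewrite IH ?(ltnW Jk)// add0e covariance_exponential// ltn_eqF.
- exact: Lfun2_exponential_sum.
- exact: Lfun2_exponential.
- exact: Lfun2_exponential.
Qed.

(** Pairwise independence kills the covariances, so the variance grows only linearly in [J]. *)
Lemma variance_exponential_sum_le J :
  ('V_P[exponential_sum J] <= (J%:R * (moment_const / r ^+ 2))%:E)%E.
Proof.
elim: J => [|J IH]; first by rewrite exponential_sum0 variance_cst mul0r.
rewrite exponential_sumS varianceD.
- rewrite covariance_exponential_sum// mule0 adde0.
  rewrite -[J.+1]addn1 natrD mulrDl mul1r EFinD.
  by apply: leeD => //; exact: variance_exponential_le.
- exact: Lfun2_exponential_sum.
- exact: Lfun2_exponential.
Qed.

(** Chebyshev's inequality; for [J] of order [r] and fixed [e] the bound is of order [1 / r]. *)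
Lemma exponential_sum_concentration J (e : R) : 0 < e ->
  (P [set w | (e <= `|exponential_sum J w - J%:R / r|)%R] <=
   (J%:R * moment_const / (r ^+ 2 * e ^+ 2))%:E)%E.
Proof.
move=> e0.
pose S : {RV P >-> R} := mfun_Sub (mem_set (measurable_exponential_sum J)).
have := chebyshev S e0; rewrite expectation_exponential_sum/=.
move=> /le_trans; apply.
apply: (@le_trans _ _ ((e ^- 2)%:E * (J%:R * (moment_const / r ^+ 2))%:E)%E).
  apply: lee_wpmul2l; first by rewrite lee_fin invr_ge0 sqr_ge0.
  exact: variance_exponential_sum_le.
rewrite -EFinM lee_fin le_eqVlt; apply/orP; left; apply/eqP; field.
by rewrite !gt_eqF.
Qed.

End exponential_sums.

(** * Poisson model *)

Section sigma_of.
Context {d d' : measure_display} {T : measurableType d} {T' : measurableType d'}.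
Variable X : T -> T'.

Lemma sigma_ofT : sigma_of X setT.
Proof. by exists setT => //; rewrite setTI preimage_setT. Qed.

Lemma sigma_ofI : setI_closed (sigma_of X).
Proof.
move=> _ _ [A mA <-] [B mB <-]; exists (A `&` B); first exact: measurableI.
by rewrite !setTI preimage_setI.
Qed.

Lemma sigma_of_preimage A : measurable A -> sigma_of X (X @^-1` A).
Proof. by move=> mA; exists A => //; rewrite setTI. Qed.

Lemma sigma_of_measurable : measurable_fun setT X -> sigma_of X `<=` measurable.
Proof. by move=> mX _ [A mA <-]; exact: mX. Qed.

End sigma_of.

Section poisson.
Context {d : measure_display} {T : measurableType d} {R : realType}.
Variables (P : probability T R) (l : nat -> R) (alpha : R).
Variables (C : nat -> nat -> T -> circle R) (Y : nat -> nat -> T -> R).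
Hypothesis l_gt0 : forall n, 0 < l n.
Hypothesis CY : poisson_input P l alpha C Y.
Variable x : circle R.

Let rate i : R := l i `^ (- alpha).

Let F (k : (nat * nat) + (nat * nat)) : set_system T :=
  match k with
  | inl (i, j) => sigma_of (C i j)
  | inr (i, j) => sigma_of (Y i j)
  end.

Let rate_gt0 i : 0 < rate i.
Proof. by rewrite powR_gt0. Qed.

Let mC i j : measurable_fun setT (C i j).
Proof. by have [/(_ i j)[]] := CY. Qed.

Let mY i j : measurable_fun setT (Y i j).
Proof. by have [_ /(_ i j)[]] := CY. Qed.

Let FT k : F k setT.
Proof. by case: k => -[i j]; exact: sigma_ofT. Qed.

Let FI k : setI_closed (F k).
Proof. by case: k => -[i j]; exact: sigma_ofI. Qed.

Let Fm k : F k `<=` measurable.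
Proof. by case: k => -[i j]; apply: sigma_of_measurable. Qed.

Let indF : mutually_independent P F.
Proof. by case: CY. Qed.

Let FC i j : F (inl (i, j)) (C i j @^-1` arc x (l i)).
Proof. by apply: sigma_of_preimage; exact: measurable_arc. Qed.

Let PC_le i j : (P (C i j @^-1` arc x (l i)) <= (3 * l i)%:E)%E.
Proof.
have [/(_ i j)[_ CU] _ _] := CY.
rewrite -[X in (X <= _)%E]/(pushforward P (C i j) _) CU.
  exact: circle_uniform_arc_le.
exact: measurable_arc.
Qed.

Let PC_ge i j : l i <= 1 -> ((l i / 2)%:E <= P (C i j @^-1` arc x (l i)))%E.
Proof.
move=> l1; have [/(_ i j)[_ CU] _ _] := CY.
rewrite -[X in (_ <= X)%E]/(pushforward P (C i j) _) CU.
  exact: circle_uniform_arc_ge.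
exact: measurable_arc.
Qed.

Let PYgt i j t : 0 <= t -> P (Y i j @^-1` `]t, +oo[) = (expR (- rate i * t))%:E.
Proof.
move=> t0; have [_ /(_ i j)[_ YE] _] := CY.
rewrite -[LHS]/(pushforward P (Y i j) _) YE//.
exact: (exponential_prob_gt (rate_gt0 i)).
Qed.

Let PYle0 i j : P (Y i j @^-1` `]-oo, 0]) = 0%E.
Proof.
have [_ /(_ i j)[_ YE] _] := CY.
rewrite -[LHS]/(pushforward P (Y i j) _) YE//.
exact: exponential_prob_le0.
Qed.

Let mYitv i j (I : interval R) : measurable (Y i j @^-1` [set` I]).
Proof. by rewrite -[X in measurable X]setTI; apply: mY => //; exact: measurable_itv. Qed.

(** * Jump times, and emptiness in the convergent case *)

Lemma measurable_jump_time i j : measurable_fun setT (jump_time Y i j).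
Proof. exact: measurable_sum. Qed.

Let mjump i j t : measurable [set w | jump_time Y i j w <= t].
Proof.
have := measurable_jump_time i j measurableT (measurable_itv `]-oo, t]).
by rewrite setTI; congr measurable; apply/seteqP; split=> w /=; rewrite in_itv.
Qed.

Lemma jump_time0 i w : jump_time Y i 0 w = 0.
Proof. by rewrite /jump_time big_ord0. Qed.

Lemma jump_timeS i j w : jump_time Y i j.+1 w = jump_time Y i j w + Y i j w.
Proof. by rewrite /jump_time big_ord_recr. Qed.

(* E (exp (- V)) for V the two-valued minorant (rate i)^-1 * 1_(Y i j > (rate i)^-1)
   of Y i j; it replaces the Laplace transform of Y i j in a Chernoff bound *)
Let c i : R := expR (- (rate i)^-1) * expR (- 1) + (1 - expR (- 1)).

Let c_gt0 i : 0 < c i.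
Proof.
rewrite /c addr_gt0 ?mulr_gt0 ?expR_gt0// subr_gt0 expR_lt1; lra.
Qed.

(** With [v = 1 / rate i], [1 - exp (- v) >= 1 - 1 / (1 + v) = 1 / (1 + rate i)]. This bounds the
    sum of the geometric series of ratio [c i]. *)
Let oneBc_ge i : expR (- 1) / (1 + rate i) <= 1 - c i.
Proof.
have -> : 1 - c i = expR (- 1) * (1 - expR (- (rate i)^-1)) by rewrite /c; ring.
rewrite ler_wpM2l ?expR_ge0// expRN.
have := expR_ge1Dx (rate i)^-1.
have v0 : 0 < (rate i)^-1 by rewrite invr_gt0.
have E0 := expR_gt0 (rate i)^-1.
move=> vE; rewrite -[leLHS]/((1 + rate i)^-1).
have -> : (1 + rate i)^-1 = 1 - (1 + (rate i)^-1)^-1.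
  by field; rewrite !gt_eqF ?addr_gt0// -?[rate i + 1]addrC ?addr_gt0.
by rewrite lerD2l lerN2 lef_pV2 ?posrE ?addr_gt0.
Qed.

(** A Chernoff bound, localized on an event [D] independent of the first [j] holding times. In the
    induction [D] absorbs the condition on the last holding time; in the application it is the event
    that a center is close to [x]. *)
Lemma jump_time_tail i j (r : R) (D : set T) :
  cylinder F [set k | forall m, (m < j)%N -> k <> inr (i, m)] D ->
  (P (D `&` [set w | (jump_time Y i j w <= r)%R]) <=
   (expR r * c i ^+ j)%:E * P D)%E.
Proof.
elim: j r D => [|j IH] r D cD.
  have mD : measurable D := cylinder_measurable Fm cD.
  have [r0|r0] := leP 0 r; last first.
    rewrite (_ : _ `&` _ = set0); last first.
      by apply/seteqP; split=> w //= -[_]; rewrite jump_time0 leNgt r0.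
    by rewrite measure0 mule_ge0// lee_fin mulr_ge0 ?expR_ge0// ltW.
  apply: (@le_trans _ _ (P D)).
    by apply: le_measure => //; rewrite inE//; exact: measurableI.
  rewrite -[leLHS]mul1e; apply: lee_wpmul2r => //.
  by rewrite lee_fin mulr1 -expR0 ler_expR.
have mD : measurable D := cylinder_measurable Fm cD.
pose v := (rate i)^-1.
have v0 : 0 < v by rewrite invr_gt0.
pose G := Y i j @^-1` `]v, +oo[; pose G' := Y i j @^-1` `]-oo, v].
have mG : measurable G by exact: mYitv.
have mG' : measurable G' by exact: mYitv.
have PG : P G = (expR (- 1))%:E.
  by rewrite /G PYgt ?(ltW v0)// mulNr divff// gt_eqF.
have PG' : P G' = (1 - expR (- 1))%:E.
  rewrite EFinB -PG -probability_setC//.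
  by congr (P _); rewrite /G /G' -setCitvr -preimage_setC.
have cG A : measurable A -> cylinder F [set inr (i, j)] (Y i j @^-1` A).
  move=> mA; apply: (@cylinder1 _ _ _ _ FT _ (inr (i, j))) => //.
  exact: sigma_of_preimage.
have cDS : cylinder F [set k | forall m, (m < j)%N -> k <> inr (i, m)] D.
  by apply: sub_cylinder cD => k kj m mj; apply: kj; exact: ltnW.
have cDG A : measurable A -> cylinder F [set k | forall m, (m < j)%N ->
    k <> inr (i, m)] (D `&` Y i j @^-1` A).
  move=> mA; apply: (cylinderI FI) => //; apply: sub_cylinder (cG _ mA) => k /= ->.
  by move=> m mj [mE]; rewrite mE ltnn in mj.
have PDG A : measurable A -> P (D `&` Y i j @^-1` A) = (P D * P (Y i j @^-1` A))%E.
  move=> mA; apply: (cylinder_indep FI indF _ cD (cG _ mA)).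
  by apply/seteqP; split=> // k /= [+ kE]; rewrite kE => /(_ j (ltnSn _)).
(* A last holding time above [v] leaves [r - v] for the others and contributes
   [exp (- v) * exp (- 1)]; one in ]0, v] contributes [1 - exp (- 1)]. These add up to [c i], and
   nonpositive values form a null set. *)
have sub : D `&` [set w | jump_time Y i j.+1 w <= r] `<=`
    (D `&` G) `&` [set w | jump_time Y i j w <= r - v] `|`
    (D `&` G') `&` [set w | jump_time Y i j w <= r] `|` Y i j @^-1` `]-oo, 0].
  move=> w /= [Dw]; rewrite jump_timeS => Tr.
  have [Yle|Yge] := leP (Y i j w) 0; first by right; rewrite /= in_itv.
  left; have [Yv|Yv] := leP (Y i j w) v.
    by right; split; [split|lra] => //; rewrite /G' /= in_itv.
  by left; split; [split|lra] => //; rewrite /G /= in_itv/= Yv.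
have mDG : measurable ((D `&` G) `&` [set w | jump_time Y i j w <= r - v]).
  by apply: measurableI => //; exact: measurableI.
have mDG' : measurable ((D `&` G') `&` [set w | jump_time Y i j w <= r]).
  by apply: measurableI => //; exact: measurableI.
apply: (@le_trans _ _
    (P ((D `&` G) `&` [set w | (jump_time Y i j w <= r - v)%R]) +
     P ((D `&` G') `&` [set w | (jump_time Y i j w <= r)%R]))%E).
  rewrite -[leRHS]adde0 -(PYle0 i j).
  apply: (le_trans (le_measure P _ _ sub)); rewrite ?inE//.
  - by apply: measurableI => //; exact: mjump.
  - by apply: measurableU => //; exact: measurableU.
  apply: (le_trans (measureU2 _ _ _)) => //; first exact: measurableU.
  by rewrite leeD2r//; exact: measureU2.
apply: (le_trans (leeD (IH _ _ (cDG _ _)) (IH _ _ (cDG _ _)))) => //.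
rewrite (PDG _ (measurable_itv _)) (PDG _ (measurable_itv _)) PG PG'.
have PDE : P D = (fine (P D))%:E by rewrite fineK// fin_num_measure.
rewrite PDE -!EFinM -EFinD lee_fin le_eqVlt; apply/orP; left; apply/eqP.
by rewrite expRD exprS /c -/v; ring.
Qed.

Let H i : set T := \bigcup_j
  (C i j @^-1` arc x (l i) `&` [set w | jump_time Y i j w <= 1]).

Let mH i : measurable (H i).
Proof.
by apply: bigcup_measurable => j _; apply: measurableI => //; exact: Fm (FC i j).
Qed.

(** Summing the tail bounds over [j] gives [3 e l / (1 - c)], at most [3 e^2 l (1 + rate)], and
    [l * rate = l^(1 - alpha)]. *)
Let PH_le i : (P (H i) <= (3 * expR 2 * (l i + l i `^ (1 - alpha)))%:E)%E.
Proof.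
have sum_le : (P (H i) <= \sum_(0 <= j <oo)
    P (C i j @^-1` arc x (l i) `&` [set w | (jump_time Y i j w <= 1)%R]))%E.
  apply: measure_sigma_subadditive => // j.
  by apply: measurableI => //; exact: Fm (FC i j).
apply: (le_trans sum_le).
have c1 : c i < 1.
  rewrite -subr_gt0; apply: lt_le_trans (oneBc_ge i).
  by rewrite divr_gt0 ?expR_gt0// addr_gt0.
apply: (@le_trans _ _ ((expR 1 * (3 * l i)) / (1 - c i))%:E).
  apply: nneseries_geometric_le => //.
    by rewrite mulr_ge0 ?expR_ge0// mulr_ge0// ltW.
  move=> j; rewrite measure_ge0/=.
  apply: (le_trans (jump_time_tail 1 _)).
    by apply: (@cylinder1 _ _ _ _ FT _ (inl (i, j))).
  rewrite [X in (_ <= X%:E)%E]mulrAC [X in (_ <= X)%E]EFinM; apply: lee_wpmul2l => //.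
  by rewrite lee_fin mulr_ge0 ?expR_ge0// exprn_ge0// ltW.
rewrite lee_fin.
have -> : l i `^ (1 - alpha) = l i * rate i.
  by rewrite powRD ?powRr1 ?(ltW (l_gt0 i))//; apply/implyP => _; rewrite gt_eqF.
apply: (@le_trans _ _ (expR 1 * (3 * l i) / (expR (- 1) / (1 + rate i)))).
  rewrite ler_wpM2l ?mulr_ge0 ?expR_ge0 ?(ltW (l_gt0 i))//.
  by rewrite lef_pV2 ?posrE ?subr_gt0// divr_gt0 ?expR_gt0// addr_gt0.
rewrite le_eqVlt; apply/orP; left; apply/eqP.
rewrite invf_div expRN (_ : 2 = 1 + 1)// expRD invrK; ring.
Qed.

(* When no index qualifies, poisson_process takes index 0, which is harmless
   here because jump_time 0 = 0 <= 1. *)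
Lemma poisson_covering_times0 :
  (\sum_(0 <= n <oo) (l n)%:E < +oo)%E ->
  (\sum_(0 <= n <oo) (l n `^ (1 - alpha))%:E < +oo)%E ->
  {ae P, forall w, covering_times l (poisson_process C Y) x w = set0}.
Proof.
move=> sl sla.
have : {ae P, forall w, ~ lim_sup_set H w}.
  apply: borel_cantelli1 => //.
  apply: (@le_lt_trans _ _ (\sum_(0 <= n <oo)
      (3 * expR 2)%:E * ((l n)%:E + (l n `^ (1 - alpha))%:E))%E).
    by apply: lee_nneseries => // n _; rewrite -EFinD -EFinM; exact: PH_le.
  rewrite nneseriesZl; last first.
    by move=> n _; rewrite -EFinD lee_fin addr_ge0 ?powR_ge0// ltW.
  rewrite nneseriesD; last 2 first.
  - by move=> n _ _; rewrite lee_fin ltW.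
  - by move=> n _ _; rewrite lee_fin powR_ge0.
  by rewrite lte_mul_pinfty ?lte_add_pinfty// lee_fin mulr_ge0 ?expR_ge0.
apply: filterS => w Hw; apply/seteqP; split=> // t [t01 Et]; apply: Hw => N _.
have [n Nn xn] := Et N I; exists n => //.
exists (xget 0%N [set j | jump_time Y n j w <= t < jump_time Y n j.+1 w]) => //.
split; first exact/arc_sym.
case: xgetP => [j _ /= /andP[Tt _]|_] /=; last by rewrite jump_time0.
by move: t01; rewrite /= in_itv/= => /andP[_]; exact: le_trans.
Qed.

(** * Nonemptiness in the divergent case *)

Let sig (S : set ((nat * nat) + (nat * nat))) : set_system T :=
  <<s \bigcup_(k in S) F k >>.

(* Y i j is nonnegative almost surely only, whereas the expectation formulas
   for exponential_sum want nonnegativity everywhere. *)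
Let Ypos i j w : R := Num.max (Y i j w) 0.

Let mYpos i j : measurable_fun setT (Ypos i j).
Proof. by apply: measurable_maxr. Qed.

Let Z i j : {RV P >-> R} := mfun_Sub (mem_set (mYpos i j)).

Let Z_ge0 i j w : 0 <= Z i j w.
Proof. by rewrite /= /Ypos le_max lexx orbT. Qed.

Let Zgt i j t : 0 <= t -> P (Z i j @^-1` `]t, +oo[) = (expR (- rate i * t))%:E.
Proof.
move=> t0; rewrite -(PYgt i j t0); congr (P _); apply/seteqP; split=> w;
  rewrite /= !in_itv/= !andbT /Ypos lt_max; first by case/orP=> //; lra.
by move=> ->.
Qed.

Let Zind i j k : j != k -> forall A B : set R, measurable A -> measurable B ->
  P (Z i j @^-1` A `&` Z i k @^-1` B) =
  (P (Z i j @^-1` A) * P (Z i k @^-1` B))%E.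
Proof.
move=> jk A B mA mB.
pose pos (y : R) := Num.max y 0.
have mpos : measurable_fun setT pos by apply: measurable_maxr.
have cZ m D : measurable D -> cylinder F [set inr (i, m)] (Z i m @^-1` D).
  move=> mD; apply: (@cylinder1 _ _ _ _ FT _ (inr (i, m))) => //.
  apply: (@sigma_of_preimage _ _ _ _ (Y i m) (pos @^-1` D)).
  by rewrite -[X in measurable X]setTI; exact: mpos.
apply: (cylinder_indep FI indF _ (cZ _ _ mA) (cZ _ _ mB)).
apply/seteqP; split=> // n [/= -> [jk']].
by rewrite jk' eqxx in jk.
Qed.

Let S i := exponential_sum (Z i).

(** Measurability holds for the sigma-algebra of any block containing the holding times of [i], as
    the grouping lemma requires. *)
Let sigmaY_measurable (I : set ((nat * nat) + (nat * nat))) i J :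
  (forall j, I (inr (i, j))) ->
  measurable_fun (setT : set (g_sigma_algebraType (\bigcup_(k in I) F k))) (S i J).
Proof.
move=> II; apply: measurable_sum => j.
apply: measurable_maxr => //.
move=> _ A mA; rewrite setTI; apply: sub_sigma_algebra.
by exists (inr (i, nat_of_ord j)) => //; exact: sigma_of_preimage.
Qed.

Section window.
Variables a b : R.
Hypotheses (a0 : 0 <= a) (b1 : b <= 1) (ab : a < b).

Let h := b - a.
(** [J1] is rounded up and [J2] down, so that the mean jump times [J1 / rate] and [J2 / rate] are at
    distance at least [h / 3] from [a] and from [b] respectively. *)
Let J1 i := (Num.truncn (rate i * (a + h / 3))).+1.
Let J2 i := Num.truncn (rate i * (a + h / 3 * 2)).

(** When the holding times are positive, on [E i] each center of index [j] with [J1 <= j < J2] is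
    held during a time interval inside ]a, b[. *)
Let E i := [set w | a < S i (J1 i) w] `&` [set w | S i (J2 i) w < b].
Let A i := \bigcup_(j in [set j | (J1 i <= j < J2 i)%N]) C i j @^-1` arc x (l i).
Let D i := E i `&` A i.

Let h0 : 0 < h. Proof. by rewrite subr_gt0. Qed.

Let J1_bounds i : rate i * (a + h / 3) < (J1 i)%:R <= rate i * (a + h / 3) + 1.
Proof.
rewrite truncnS_gt/= /J1 -[_.+1]addn1 natrD lerD2r.
have /truncn_itv/andP[] // : 0 <= rate i * (a + h / 3).
by apply: mulr_ge0; [exact: ltW|move: a0 h0; lra].
Qed.

Let J2_bounds i : rate i * (a + h / 3 * 2) - 1 < (J2 i)%:R
  <= rate i * (a + h / 3 * 2).
Proof.
have /truncn_itv/andP[-> H2] : 0 <= rate i * (a + h / 3 * 2).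
  by apply: mulr_ge0; [exact: ltW|move: a0 h0; lra].
by rewrite andbT ltrBlDr natr1.
Qed.

Let sigE (I : set ((nat * nat) + (nat * nat))) i :
  (forall j, I (inr (i, j))) -> sig I (E i).
Proof.
move=> II; apply: (@measurableI _ (g_sigma_algebraType (\bigcup_(k in I) F k))).
- have := sigmaY_measurable (J1 i) II measurableT (measurable_itv `]a, +oo[).
  rewrite setTI; congr measurable; apply/seteqP; split=> w /=;
    by rewrite in_itv/= andbT.
- have := sigmaY_measurable (J2 i) II measurableT (measurable_itv `]-oo, b[).
  by rewrite setTI; congr measurable; apply/seteqP; split=> w /=; rewrite in_itv.
Qed.

Let sigA (I : set ((nat * nat) + (nat * nat))) i :
  (forall j, I (inl (i, j))) -> sig I (A i).
Proof.
move=> II.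
apply: (@countable_bigcup_measurable _ (g_sigma_algebraType (\bigcup_(k in I) F k))).
by move=> j _; apply: sub_sigma_algebra; exists (inl (i, j)).
Qed.

Let sig_measurable I : sig I `<=` measurable.
Proof.
apply: smallest_sub; first exact: sigma_algebra_measurable.
by move=> B [k _]; exact: Fm.
Qed.

Let mE i : measurable (E i).
Proof. by apply: (@sig_measurable setT); exact: sigE. Qed.

Let mA i : measurable (A i).
Proof. by apply: (@sig_measurable setT); exact: sigA. Qed.

(** Grouping into two blocks, all the centers and all the holding times. *)
Let PD i : P (D i) = (P (E i) * P (A i))%E.
Proof.
pose g (k : (nat * nat) + (nat * nat)) := if k is inl _ then true else false.
have indg := mutually_independent_group (g := g) FT FI Fm indF.
have := indg [:: true; false] (fun c => if c then A i else E i) isT.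
rewrite big_cons big_seq1 muleC => <-.
- congr (P _); rewrite /D setIC; apply/seteqP; split=> w.
    by move=> [Aw Ew] [].
  by move=> Hw; split; [have := Hw true; exact|have := Hw false; exact].
- by case=> _; [exact: sigA|exact: sigE].
Qed.

Let PE_ge i : 54 * moment_const / h ^+ 2 <= rate i -> 1 <= rate i ->
  ((2^-1)%:E <= P (E i))%E.
Proof.
move=> r1 r2; pose B J := [set w | h / 3 <= `|S i J w - J%:R / rate i|].
have h30 : 0 < h / 3 by rewrite divr_gt0.
have mB J : measurable (B J).
  have mf : measurable_fun setT (fun w => `|S i J w - J%:R / rate i|).
    apply: measurableT_comp => //; apply: measurable_funB => //.
    exact: measurable_exponential_sum.
  have := mf measurableT _ (measurable_itv `[h / 3, +oo[).
  rewrite setTI; congr measurable; apply/seteqP; split=> w /=;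
    by rewrite in_itv/= andbT.
have h20 : 0 < h ^+ 2 by rewrite exprn_gt0.
(* For [J <= m * rate], Chebyshev with deviation [h / 3] gives [9 m K / (rate h^2)], where [K] is
   [moment_const]; the constant 54 makes this at most [m / 6]. With [m = 2] for [J1], whose rounding
   costs 1, and [m = 1] for [J2], the total is 1/2. *)
have PB J (m c0 : R) : J%:R <= m * rate i ->
    m * 9 * moment_const <= c0 * (54 * moment_const) -> 0 <= c0 ->
    (P (B J) <= c0%:E)%E.
  move=> Jm mc c00.
  have := exponential_sum_concentration (rate_gt0 i) (Z_ge0 i)
    (fun k t => @Zgt i k t) (fun j k => @Zind i j k) J h30.
  move=> /le_trans; apply; rewrite lee_fin.
  have K0 := moment_const_gt0 R.
  rewrite ler_pdivrMr ?mulr_gt0 ?exprn_gt0//.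
  have : 54 * moment_const <= rate i * h ^+ 2 by rewrite -ler_pdivrMr.
  move=> /(ler_wpM2l c00) rh.
  have : J%:R * moment_const <= m * rate i * moment_const by rewrite ler_wpM2r// ltW.
  move=> /le_trans; apply.
  have : rate i * (m * 9 * moment_const) <= rate i * (c0 * (rate i * h ^+ 2)).
    by apply: ler_wpM2l; [exact: ltW|exact: le_trans rh].
  have -> : (h / 3) ^+ 2 = h ^+ 2 / 9 by field.
  by nra.
have /andP[J1l J1u] := J1_bounds i; have /andP[J2l J2u] := J2_bounds i.
have h1 : h <= 1 by move: a0 b1; rewrite /h; lra.
have PB1 : (P (B (J1 i)) <= (3^-1)%:E)%E.
  apply: (PB _ 2); rewrite ?invr_ge0//; last by lra.
  apply: (le_trans J1u); have : a + h / 3 <= 1 by move: a0 b1 ab; rewrite /h; lra.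
  by nra.
have PB2 : (P (B (J2 i)) <= (6^-1)%:E)%E.
  apply: (PB _ 1); rewrite ?invr_ge0//; last by lra.
  apply: (le_trans J2u); have : a + h / 3 * 2 <= 1 by move: a0 b1 ab; rewrite /h; lra.
  by nra.
have sub : ~` E i `<=` B (J1 i) `|` B (J2 i).
  move=> w; rewrite /E setCI => -[/= Sa|/= Sb].
    left; rewrite /B /= ler_normr; apply/orP; right.
    move/negP : Sa; rewrite -leNgt => Sa.
    have : a + h / 3 <= (J1 i)%:R / rate i by rewrite ler_pdivlMr// mulrC ltW.
    by lra.
  right; rewrite /B /= ler_normr; apply/orP; left.
  move/negP : Sb; rewrite -leNgt => Sb.
  have : (J2 i)%:R / rate i <= a + h / 3 * 2 by rewrite ler_pdivrMr// mulrC.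
  by move: Sb; rewrite /h; lra.
have PEc : (P (~` E i) <= (2^-1)%:E)%E.
  apply: (@le_trans _ _ (P (B (J1 i)) + P (B (J2 i)))%E).
    apply: (@le_trans _ _ (P (B (J1 i) `|` B (J2 i)))).
      apply: le_measure => //; rewrite inE; first exact: measurableC.
      exact: measurableU.
    exact: measureU2.
  apply: le_trans (leeD PB1 PB2) _; rewrite -EFinD lee_fin; lra.
rewrite probability_setC// in PEc.
have PEE : P (E i) = (fine (P (E i)))%:E by rewrite fineK// fin_num_measure.
by move: PEc; rewrite PEE -EFinB !lee_fin; lra.
Qed.

(** All centers miss with probability at most [exp (- (J2 - J1) l / 2)]. Here [J2 - J1] is at least
    [rate h / 3 - 2], hence at least [rate h / 6] because [rate h >= 12]; this gives
    [exp (- y) <= 1 / (1 + y)]. *)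
Let PA_ge i : l i <= 1 -> 12 / h <= rate i ->
  ((rate i * l i * (h / 12) / (1 + rate i * l i * (h / 12)))%:E <= P (A i))%E.
Proof.
move=> l1 r1; set y := rate i * l i * (h / 12).
have y0 : 0 < y by rewrite mulr_gt0 ?divr_gt0 ?mulr_gt0.
pose q := fine (P (A i)).
have qE : P (A i) = q%:E by rewrite fineK// fin_num_measure.
pose s : seq ((nat * nat) + (nat * nat)) :=
  [seq inl (i, j) | j <- index_iota (J1 i) (J2 i)].
pose G (k : (nat * nat) + (nat * nat)) := if k is inl (_, j) then
  ~` (C i j @^-1` arc x (l i)) else setT.
have AG : ~` A i = \bigcap_(k in [set` s]) G k.
  rewrite setC_bigcup; apply/seteqP; split=> w Hw.
    move=> k /= /mapP[j]; rewrite mem_index_iota => jJ ->; exact: Hw.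
  move=> j /= jJ; have := Hw (inl (i, j)); apply => /=.
  by apply: map_f; rewrite mem_index_iota.
have PG j : (P (G (inl (i, j))) <= (expR (- (l i / 2)))%:E)%E.
  have mCj := Fm (FC i j).
  have CE : P (C i j @^-1` arc x (l i)) =
      (fine (P (C i j @^-1` arc x (l i))))%:E by rewrite fineK// fin_num_measure.
  have := PC_ge j l1; rewrite /G probability_setC// CE -EFinB !lee_fin => Cge.
  by apply: le_trans (expR_ge1Dx _); lra.
have PAc : (P (~` A i) <= (expR (- y))%:E)%E.
  rewrite AG indF; last 2 first.
  - by rewrite map_inj_uniq ?iota_uniq// => j k [].
  - move=> k /mapP[j _ ->]; rewrite /= preimage_setC.
    by apply: sigma_of_preimage; apply: measurableC; exact: measurable_arc.
  rewrite big_map.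
  have GE j : P (G (inl (i, j))) = (fine (P (G (inl (i, j)))))%:E.
    rewrite fineK// fin_num_measure//=; apply: measurableC.
    exact: Fm (FC i j).
  under eq_bigr do rewrite GE.
  rewrite prodEFin lee_fin.
  apply: (@le_trans _ _ (\prod_(J1 i <= j < J2 i) expR (- (l i / 2)))).
    apply: ler_prod => j _; rewrite fine_ge0//= -lee_fin -GE.
    exact: PG.
  rewrite -expR_sum ler_expR big_const_nat iter_addr_0 mulNrn lerN2.
  rewrite -[_ *+ (J2 i - J1 i)]mulr_natl.
  have /andP[J1l J1u] := J1_bounds i; have /andP[J2l J2u] := J2_bounds i.
  have JJ : (J2 i)%:R - (J1 i)%:R <= (J2 i - J1 i)%:R :> R.
    by rewrite lerBlDr -natrD ler_nat addnC -leq_subLR.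
  have : 12 <= rate i * h by rewrite -ler_pdivrMr.
  have l0 := l_gt0 i.
  move=> rh; have : rate i * h / 6 <= (J2 i - J1 i)%:R by lra.
  move=> /(ler_wpM2r (ltW l0)); rewrite /y; lra.
rewrite qE lee_fin.
have : expR (- y) <= (1 + y)^-1.
  rewrite expRN lef_pV2 ?posrE ?expR_gt0 ?addr_gt0//; exact: expR_ge1Dx.
move: PAc; rewrite probability_setC// qE -EFinB lee_fin.
have -> : y / (1 + y) = 1 - (1 + y)^-1 by field; lra.
by lra.
Qed.

Let PD_ge i : l i <= 1 -> 1 <= rate i -> 12 / h <= rate i ->
  54 * moment_const / h ^+ 2 <= rate i ->
  ((Num.min (h / 48) (h / 48 * l i `^ (1 - alpha)))%:E <= P (D i))%E.
Proof.
move=> l1 r1 r2 r3; rewrite PD.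
have -> : l i `^ (1 - alpha) = rate i * l i.
  rewrite addrC powRD ?powRr1 ?(ltW (l_gt0 i))//.
  by apply/implyP => _; rewrite gt_eqF.
have := PA_ge l1 r2; set y := rate i * l i * (h / 12) => PA.
have y0 : 0 < y by rewrite mulr_gt0 ?divr_gt0 ?mulr_gt0.
have h1 : h <= 1 by move: a0 b1; rewrite /h; lra.
apply: (@le_trans _ _ ((2^-1)%:E * (y / (1 + y))%:E)%E); last first.
  apply: lee_pmul => //; first by rewrite lee_fin divr_ge0; lra.
  exact: PE_ge.
rewrite -EFinM lee_fin ge_min.
have -> : h / 48 * (rate i * l i) = y / 4 by rewrite /y; field.
(* [y / (1 + y)] is at least [y / 2] if [y <= 1] and at least 1/2 otherwise; the second case uses
   [h <= 1]. *)
have [y1|y1] := leP y 1; apply/orP; [right|left].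
- have : y / 2 <= y / (1 + y).
    by rewrite ler_wpM2l ?(ltW y0)// lef_pV2 ?posrE; lra.
  by lra.
- have : 2^-1 <= y / (1 + y) by rewrite ler_pdivlMr; lra.
  by lra.
Qed.

Lemma window_hit_ae : 0 <= alpha ->
  (\sum_(0 <= n <oo) (l n)%:E < +oo)%E ->
  (\sum_(0 <= n <oo) (l n `^ (1 - alpha))%:E = +oo)%E ->
  {ae P, forall w, lim_sup_set D w}.
Proof.
move=> alpha0 sl sla.
(* For [alpha = 0] the convergent and the divergent series would coincide. Hence [alpha > 0] and the
   rates tend to infinity, as the bounds on [E] and [A] require. *)
have {}alpha0 : 0 < alpha.
  rewrite lt_neqAle alpha0 andbT; apply/eqP => aE.
  move: sl; rewrite (eq_eseriesr (g := fun n => (l n `^ (1 - alpha))%:E)).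
    by rewrite sla.
  by move=> n _; rewrite -aE subr0 powRr1// ltW.
have l_cvg0 (e : R) : 0 < e -> \forall n \near \oo, l n < e.
  move=> e0; have l_ge0 n : (0 <= (l n)%:E)%E by rewrite lee_fin ltW.
  by apply: filterS (nneseries_lt_near e0 l_ge0 sl) => n; rewrite lte_fin.
have rate_ge (M : R) : 0 < M -> \forall n \near \oo, M <= rate n.
  move=> M0; have e0 : 0 < M^-1 `^ alpha^-1 by rewrite powR_gt0// invr_gt0.
  apply: filterS (l_cvg0 _ e0) => n le.
  rewrite /rate powRN -[M]invrK lef_pV2 ?posrE ?invr_gt0 ?powR_gt0//.
  have -> : M^-1 = (M^-1 `^ alpha^-1) `^ alpha.
    by rewrite -powRrM mulVf ?powRr1 ?invr_ge0 ?(ltW M0)// gt_eqF.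
  by apply: ge0_ler_powR; rewrite ?nnegrE ?(ltW alpha0)// ltW// powR_gt0// invr_gt0.
have K0 : 0 < 54 * moment_const / h ^+ 2 :> R.
  by rewrite divr_gt0 ?mulr_gt0 ?moment_const_gt0 ?exprn_gt0.
have r12 : 0 < 12 / h by rewrite divr_gt0.
have [N _ HN] : \forall n \near \oo, ((Num.min (h / 48)
    (h / 48 * l n `^ (1 - alpha)))%:E <= P (D n))%E.
  near=> n; apply: PD_ge.
  - by apply: ltW; near: n; exact: l_cvg0.
  - by near: n; exact: rate_ge.
  - by near: n; exact: rate_ge.
  - by near: n; exact: rate_ge.
(* A second grouping, now by the first index, makes the [D i] independent. *)
pose g (k : (nat * nat) + (nat * nat)) :=
  match k with inl (i, _) => i | inr (i, _) => i end.
have indg := mutually_independent_group (g := g) FT FI Fm indF.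
have sigD i : sig (g @^-1` [set i]) (D i).
  apply: (@measurableI _ (g_sigma_algebraType _)); first exact: sigE.
  exact: sigA.
apply: (borel_cantelli2 indg).
- by move=> n; exact: measurableI.
- by move=> n; apply: g_sigma_algebraC; exact: sigD.
- apply: (@nneseries_min_pinfty _ _ _ (h / 48) N _ _ _ _ sla) => //.
  + by rewrite divr_gt0.
  + by move=> n; exact: powR_ge0.
Unshelve. all: by end_near.
Qed.

Lemma window_hit_interior w : (forall i j, 0 < Y i j w) -> forall i, D i w ->
  [set t | arc (poisson_process C Y i t w) (l i) x]° `&` `]a, b[ !=set0.
Proof.
move=> Y0 i [[/= aS Sb] [j /= /andP[J1j jJ2] xj]].
have SE J : S i J w = jump_time Y i J w.
  apply: eq_bigr => k _; rewrite /= /Ypos; apply/max_idPl; exact: ltW.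
have Tlt : {homo (fun J => jump_time Y i J w) : m n / (m < n)%N >-> m < n}.
  apply: homo_ltn => [? ? ?|J]; first exact: lt_trans.
  by rewrite jump_timeS ltrDl.
have Tle : {homo (fun J => jump_time Y i J w) : m n / (m <= n)%N >-> m <= n}.
  exact: ltW_homo.
move: aS Sb; rewrite !SE => aS Sb.
have aT := lt_le_trans aS (Tle _ _ J1j).
have Tb := le_lt_trans (Tle _ _ jJ2) Sb.
have Tjj := Tlt j j.+1 (ltnSn j).
set u := jump_time Y i j w in aT Tjj; set v := jump_time Y i j.+1 w in Tb Tjj.
(* Jump times increase strictly, so [j] is the only index that [xget] can return on [u, v[. *)
have proc t : u <= t < v -> poisson_process C Y i t w = C i j w.
  move=> /andP[ut tv]; rewrite /poisson_process; congr (C i _ w).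
  apply: xget_unique; first by rewrite /= ut.
  move=> k /= /andP[kt tk]; apply/eqP; rewrite eqn_leq; apply/andP; split.
    rewrite leqNgt; apply/negP => /Tle; rewrite -/v; lra.
  by rewrite leqNgt; apply/negP => /Tle; rewrite -/u; lra.
exists ((u + v) / 2); split; last by rewrite /= in_itv/=; apply/andP; split; lra.
have : nbhs ((u + v) / 2) `]u, v[%classic.
  apply: open_nbhs_nbhs; split; first exact: (@itv_open _ R).
  by rewrite /= in_itv/=; apply/andP; split; lra.
apply: filterS => t /=; rewrite in_itv/= => /andP[ut tv].
by rewrite proc ?(ltW ut)//; exact/arc_sym.
Qed.

End window.

Lemma poisson_covering_times_neq0 : 0 <= alpha ->
  (\sum_(0 <= n <oo) (l n)%:E < +oo)%E ->
  (\sum_(0 <= n <oo) (l n `^ (1 - alpha))%:E = +oo)%E ->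
  {ae P, forall w, covering_times l (poisson_process C Y) x w != set0}.
Proof.
move=> alpha0 sl sla; apply: ae_covering_times => p q p0 q1 pq.
have pq' : (ratr p : R) < ratr q by rewrite ltr_rat.
have Y0 : {ae P, forall w, forall ij : nat * nat, 0 < Y ij.1 ij.2 w}.
  apply: (@ae_forall_countable _ _ _ P (nat * nat)%type
    (fun ij w => 0 < Y ij.1 ij.2 w)) => -[i j] /=.
  exists (Y i j @^-1` `]-oo, 0]); split=> //.
  by move=> w /= /negP; rewrite -leNgt in_itv.
apply: filterS2 Y0 (window_hit_ae p0 q1 pq' alpha0 sl sla) => w Yw Dw N.
have [n Nn Dn] := Dw N I; exists n => //.
exact: (window_hit_interior (fun i j => Yw (i, j)) Dn).
Qed.

End poisson.

Theorem theorem1p7 (R : realType) (d : measure_display) (Omega : measurableType d)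
    (P : probability Omega R) (l : nat -> R) (l_gt0 : forall n, 0 < l n)
    (l_decr : nonincreasing_seq l)
    (l_sum : (\sum_(0 <= n <oo) (l n)%:E < +oo)%E) (x : circle R) :
  (forall U : nat -> R -> Omega -> circle R, brownian_model P U ->
     {ae P, forall w, covering_times l U x w != set0}) /\
  (forall (alpha : R) (C : nat -> nat -> Omega -> circle R)
     (Y : nat -> nat -> Omega -> R),
     0 <= alpha -> poisson_input P l alpha C Y ->
     ((\sum_(0 <= n <oo) (l n `^ (1 - alpha))%:E < +oo)%E ->
        {ae P, forall w, covering_times l (poisson_process C Y) x w = set0}) /\
     ((\sum_(0 <= n <oo) (l n `^ (1 - alpha))%:E = +oo)%E ->
        {ae P, forall w, covering_times l (poisson_process C Y) x w != set0})).
Proof.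
split=> [U BU|alpha C Y alpha0 CY]; first exact: brownian_covering_times.
split=> [sla|sla]; first exact: (poisson_covering_times0 l_gt0 CY).
exact: (poisson_covering_times_neq0 l_gt0 CY).
Qed.
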